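(* Let $q=e^{2\pi i\tau}$ with $\tau=x+iy$, $x,y\in\mathbb R$, $y>0$, and let $F(q)$ and $S(A,B,C;t)$ be as defined in the context. Then $$F(q)=\frac{120y^3}{\pi^2}S(1,2x,x^2+y^2;2)+\frac{60i}{\pi^2}\sum_{\substack{n,k\in\mathbb Z\\ n\ne0}}\frac{(k+nx)\left((k+nx)^2+3n^2y^2\right)}{n^3\left((k+nx)^2+n^2y^2\right)^2}.$$ If $x\in\frac12\mathbb Z$ and $y>0$, then $$F(q)=\frac{120y^3}{\pi^2}S(1,2x,x^2+y^2;2).$$ If $2x/(x^2+y^2)\in\mathbb Z$ and $y>0$, then $$F(q)=\frac{120y^3}{\pi^2}S(1,2x,x^2+y^2;2)+\frac{4i\pi^2}{3}\,x\left(\frac{x^2+3y^2}{(x^2+y^2)^2}+x^2+3y^2-5\right).$$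
   Context: For $0<|q|<1$, $$F(q)=-\frac{\log^3|q|}{3\pi}+\frac{120}{\pi}\zeta(3)+\frac{240}{\pi}\sum_{j=1}^{\infty}\left(\mathrm{Li}_3(q^j)-\log|q^j|\,\mathrm{Li}_2(q^j)\right),$$ where $\mathrm{Li}_k(w)=\sum_{m\ge1}w^m/m^k$. The Epstein zeta function is $$S(A,B,C;t)=\sum_{(n,m)\in\mathbb Z^2\setminus\{(0,0)\}}\frac{1}{(An^2+Bnm+Cm^2)^t}.$$ The double sum over $n\ne0$ and $k$ in the first identity is to be read as $\sum_{n\neq0}\lim_{K\to\infty}\sum_{k=-K}^{K}$ (the inner sum over $k$ is only conditionally convergent and is taken symmetrically). *)

(* Defs.v *)
From HB Require Import structures.
From mathcomp Require Import all_boot all_order all_algebra.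
From mathcomp Require Export complex.
From mathcomp Require Import all_classical all_reals all_analysis.

Set Implicit Arguments.
Unset Strict Implicit.
Unset Printing Implicit Defensive.

Import Order.TTheory GRing.Theory Num.Theory.
Import numFieldNormedType.Exports.

Local Open Scope classical_set_scope.
Local Open Scope ring_scope.
Local Open Scope complex_scope.

(* R[i] carries no topology of its own; R[i]^o is the same type with the
   topology of the modulus |.|, in which this limit is taken. *)
Definition cseries (R : realType) (u : nat -> R[i]) : R[i] :=
  limn (series u : nat -> R[i]^o).

Definition cabs (R : realType) (z : R[i]) : R := ComplexField.Normc.normc z.

(* e^(a + ib) = e^a (cos b + i sin b) *)
Definition cexp (R : realType) (z : R[i]) : R[i] :=
  (expR (complex.Re z))%:C * (cos (complex.Im z) +i* sin (complex.Im z)).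

Definition Li (R : realType) (k : nat) (w : R[i]) : R[i] :=
  cseries (fun m => w ^+ m.+1 / m.+1%:R ^+ k).

(* The Riemann zeta function at an integer k >= 2. *)
Definition zeta (R : realType) (k : nat) : R :=
  limn (series (fun m => m.+1%:R ^- k : R)).

(* Meant for 0 < |q| < 1, where all the series below converge. *)
Definition F (R : realType) (q : R[i]) : R[i] :=
  (- (ln (cabs q) ^+ 3 / (3 * pi)))%:C
  + (120 / pi * zeta R 3)%:C
  + (240 / pi)%:C *
    cseries (fun j => Li 3 (q ^+ j.+1)
                      - (ln (cabs (q ^+ j.+1)))%:C * Li 2 (q ^+ j.+1)).

(* The Epstein zeta function, for a real exponent t. The terms are nonnegative,
   so the sum over Z^2 minus the origin is unordered. *)
Definition epstein_zeta (R : realType) (A B C t : R) : R :=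
  fine (\esum_(p in [set p : int * int | p <> (0, 0)])
    (((A * p.1%:~R ^+ 2 + B * p.1%:~R * p.2%:~R + C * p.2%:~R ^+ 2) `^ t)^-1)%:E).

Definition symmetric_partial_sum (R : realType) (f : int -> R) (K : nat) : R :=
  \sum_(i < K.*2.+1) f (i%:Z - K%:Z).

Definition symmetric_sum (R : realType) (f : int -> R) : R :=
  limn (symmetric_partial_sum f).

(* The sum of an absolutely summable real family, as the difference of the sums
   of its positive and negative parts. *)
Definition unordered_sum (R : realType) (T : choiceType) (D : set T)
    (f : T -> R) : R :=
  fine (\esum_(i in D) ((EFin \o f)^\+ i) - \esum_(i in D) ((EFin \o f)^\- i))%E.

Definition lattice_term (R : realType) (x y : R) (n k : int) : R :=
  let u := k%:~R + n%:~R * x in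
  u * (u ^+ 2 + 3 * n%:~R ^+ 2 * y ^+ 2) /
  (n%:~R ^+ 3 * (u ^+ 2 + n%:~R ^+ 2 * y ^+ 2) ^+ 2).

(* Main.v *)
Require Import Defs.
From HB Require Import structures.
From mathcomp Require Import all_boot all_order all_algebra.
From mathcomp Require Import all_classical all_reals all_analysis.
From mathcomp Require Import ring lra zify.

(** For [b > 0] and [s = u + i b],
<<
  i / s - b / s^2 = 2 b^3 / (u^2 + b^2)^2 + i u (u^2 + 3 b^2) / (u^2 + b^2)^2.
>>
    With [u = k + n x] and [b = n y], the real part is the general term of the
    Epstein zeta function and the imaginary part is that of the conditionally
    convergent double sum, both up to a factor depending on [n] only. The sums
    over [k] are thus given at once by the partial fraction expansions of
    [pi cot (pi z)] and [pi^2 / sin^2 (pi z)] ([eisenstein1], [eisenstein2]),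
    whose values at [z = n tau] are power series in [q^n]: for [w = q^n],
<<
  sum_k (i / s - b / s^2) = pi + 2 pi sum_(j >= 1) (1 + 2 pi b j) w^j.
>>
    Dividing by [n^3] and summing over [n], an exchange of the sums over [n] and
    [j] produces the polylogarithms in [F] ([ccvg_lambert_term]). The rows [n]
    and [-n] contribute equally, the term [pi] yields [zeta 3], and the row
    [n = 0] of the Epstein zeta function, [2 zeta 4 = pi^4 / 45], yields the cube
    of the logarithm. This is the first formula. The partial fraction expansions
    are limits, by Tannery's theorem, of finite identities on roots of unity.

    If [2 x] is an integer then [q] is real, all the power series above are real,
    and the second term of the formula, the odd part of [F], vanishes.

    For the last formula one compares the odd parts at [tau] and at [-1 / tau],
    whose real part [- x / |tau|^2] is half an integer, so that the odd part
    vanishes there. Grouping [k] with [-k] makes the double sum absolutely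
    convergent ([lattice_pair_bound]), and the map [(n, k) -> (k, -n)] carries its
    general term to that of [-1 / tau] up to a rational function with poles on the
    axes only ([lattice_term_modular]). The defect comes from the terms on the
    axes, which give multiples of [zeta 4], and from a multiple of
    [1 / (n^2 k^2)], which gives one of [zeta 2 ^ 2]
    ([lambert_term_modular]).

    The value of [zeta 2] follows from [eisenstein1] at [z = i b] when [b] tends
    to 0. The relation [5 zeta 4 = 2 zeta 2 ^ 2] is the comparison above at
    [tau = (1 + i) / 2], where both odd parts vanish. *)

Import Order.TTheory GRing.Theory Num.Theory.
Import numFieldNormedType.Exports.

Local Open Scope classical_set_scope.
Local Open Scope ring_scope.
Local Open Scope complex_scope.

(** * Series, Tannery's theorem and the exchange of summations *)

Lemma eq_cvgn (T : topologicalType) (u v : nat -> T) (l : T) :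
  (forall n, v n = u n) -> u @ \oo --> l -> v @ \oo --> l.
Proof. by move=> /funext ->. Qed.

Lemma cvg_sum (K : numFieldType) (V : normedModType K) (I : Type) (r : seq I)
    (P : pred I) (u : I -> nat -> V) (l : I -> V) :
  (forall i, P i -> u i n @[n --> \oo] --> l i) ->
  \sum_(i <- r | P i) u i n @[n --> \oo] --> \sum_(i <- r | P i) l i.
Proof. by move=> ul; apply: cvg_big => //; exact: add_continuous. Qed.

Lemma cvg_seriesD (K : numFieldType) (V : normedModType K) (u v : nat -> V)
    (a b : V) :
  series u @ \oo --> a -> series v @ \oo --> b ->
  series (fun n => u n + v n) @ \oo --> a + b.
Proof. by move=> ua vb; rewrite (seriesD u v); exact: cvgD. Qed.

Lemma cvg_seriesZ (K : numFieldType) (V : normedModType K) (u : nat -> V)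
    (c : K) (a : V) :
  series u @ \oo --> a -> series (fun n => c *: u n) @ \oo --> c *: a.
Proof. by move=> ua; rewrite (seriesZ u c); exact: cvgZl_tmp. Qed.

Lemma cvg_seriesM (K : numFieldType) (u : nat -> K) (c a : K) :
  series u @ \oo --> a -> series (fun n => c * u n) @ \oo --> c * a.
Proof. exact: cvg_seriesZ. Qed.

Lemma cvg_series_sub (K : numFieldType) (V : normedModType K) (u v : nat -> V)
    (a b : V) :
  series u @ \oo --> a -> series v @ \oo --> b ->
  series (fun n => u n - v n) @ \oo --> a - b.
Proof.
move=> ua vb; apply: cvg_seriesD => //.
by rewrite (seriesN v); exact: cvgN.
Qed.

Lemma series_tail_le (R : realType) (u h : nat -> R) (l H : R) K :
  series u @ \oo --> l -> series h @ \oo --> H ->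
  (forall k, `|u k| <= h k) -> `|l - series u K| <= H - series h K.
Proof.
move=> ul hH uh.
have cu : (fun m => `|series u m - series u K|) @ \oo --> `|l - series u K|.
  by apply: cvg_norm; apply: cvgB => //; exact: cvg_cst.
have ch : (fun m => series h m - series h K) @ \oo --> H - series h K.
  by apply: cvgB => //; exact: cvg_cst.
rewrite -(cvg_lim _ cu)// -(cvg_lim _ ch)//.
apply: ler_lim; [exact: (cvgP _ cu) | exact: (cvgP _ ch) | ].
exists K => // m /= Km; rewrite !sub_series Km.
by apply: le_trans (ler_norm_sum _ _ _) _; apply: ler_sum => i _; exact: uh.
Qed.

(** A head of [Phi] on which [F n] is uniformly close to it, and two tails
    bounded by the tail of [h] independently of [n], make three errors of size
    at most e / 3. *)
Lemma tannery (R : realType) (F : nat -> nat -> R) (Phi h s : nat -> R) :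
  cvgn (series h) -> (forall n k, `|F n k| <= h k) ->
  (forall k, (F ^~ k) @ \oo --> Phi k) ->
  (forall n, series (F n) @ \oo --> s n) ->
  exists L : R, series Phi @ \oo --> L /\ s @ \oo --> L.
Proof.
move=> ch Fh FPhi Fs.
have Ph k : `|Phi k| <= h k.
  rewrite -(cvg_lim _ (cvg_norm (FPhi k)))//.
  apply: limr_le; first exact: (cvgP _ (cvg_norm (FPhi k))).
  by exists 0%N => // n _ /=.
have cPhi : cvgn (series Phi).
  apply: normed_cvg; apply: series_le_cvg ch => //= n.
  by apply: le_trans (Ph n).
(* K cuts the tail of h, then N brings the first K terms together. *)
exists (limn (series Phi)); split => //.
apply/cvgrPdist_lt => e e0.
have e3 : 0 < e / 3 by rewrite divr_gt0.
have [K _ /(_ K (leqnn K)) /= hK] := (cvgrPdist_lt _ _).1 ch _ e3.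
have cK : (fun n => series (F n) K) @ \oo --> series Phi K.
  rewrite /series /=; apply: cvg_sum => i _; exact: FPhi.
have [N _ HN] := (cvgrPdist_lt _ _).1 cK _ e3.
exists N => // n /= /HN /= Nn.
have t1 := series_tail_le _ _ _ _ _ K cPhi ch Ph.
have t2 := series_tail_le _ _ _ _ _ K (Fs n) ch (Fh n).
have hK' := le_lt_trans (ler_norm _) hK.
rewrite (_ : _ - s n = (limn (series Phi) - series Phi K)
   + (series Phi K - series (F n) K) - (s n - series (F n) K)); last by ring.
apply: le_lt_trans (ler_normB _ _) _.
apply: le_lt_trans (lerD (ler_normD _ _) (lexx _)) _.
lra.
Qed.

(** The partial sums over [n], seen as series in [k], are dominated by
    [(sum g) * h], so Tannery's theorem passes to the limit in [n]. *)
Lemma series_exchange (R : realType) (f : nat -> nat -> R) (g h r c : nat -> R) :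
  cvgn (series g) -> cvgn (series h) ->
  (forall n, 0 <= g n) -> (forall k, 0 <= h k) ->
  (forall n k, `|f n k| <= g n * h k) ->
  (forall n, series (f n) @ \oo --> r n) ->
  (forall k, series (f ^~ k) @ \oo --> c k) ->
  exists S : R, series r @ \oo --> S /\ series c @ \oo --> S.
Proof.
move=> cg ch g0 h0 fgh fr fc.
have [||||S [S1 S2]] := @tannery R (fun N k => series (f ^~ k) N) c
  (fun k => limn (series g) * h k) (series r).
- exact: (cvgP _ (cvg_seriesM _ _ (limn (series g)) _ ch)).
- move=> N k; apply: le_trans (ler_norm_sum _ _ _) _ => /=.
  apply: (@le_trans _ _ (\sum_(0 <= i < N) g i * h k)).
    by apply: ler_sum => i _; exact: fgh.
  rewrite -mulr_suml ler_wpM2r//.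
  apply: nondecreasing_cvgn_le => //; exact: nondecreasing_series.
- by move=> k; exact: fc.
- move=> N; rewrite (_ : series _ = fun m => \sum_(0 <= n < N) series (f n) m).
    by rewrite /series /=; apply: cvg_sum => i _; exact: fr.
  by apply/funext => m; rewrite /series /= exchange_big.
- by exists S.
Qed.

(** * Convergence of complex sequences, componentwise *)

(** Splitting into real and imaginary parts turns every statement about complex
    limits into two statements about the complete ordered field [R]; [ccvgE]
    identifies this with convergence for the modulus. *)
Definition ccvg (R : realType) (u : nat -> R[i]) (l : R[i]) :=
  (fun n => complex.Re (u n)) @ \oo --> complex.Re l /\
  (fun n => complex.Im (u n)) @ \oo --> complex.Im l.

Arguments ccvg {R}.

Section complex_modulus.
Variable R : realType.
Implicit Types (z w : R[i]) (x y : R).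

Lemma ReD z w : complex.Re (z + w) = complex.Re z + complex.Re w.
Proof. by case: z; case: w. Qed.

Lemma ImD z w : complex.Im (z + w) = complex.Im z + complex.Im w.
Proof. by case: z; case: w. Qed.

Lemma cabsE z :
  cabs z = Num.sqrt (complex.Re z ^+ 2 + complex.Im z ^+ 2).
Proof. by case: z. Qed.

Lemma cabs_norm z : `|z| = (cabs z)%:C.
Proof. by rewrite normc_def cabsE. Qed.

Lemma cabs_ge0 z : 0 <= cabs z.
Proof. by rewrite cabsE sqrtr_ge0. Qed.

Lemma cabsM z w : cabs (z * w) = cabs z * cabs w.
Proof. exact: ComplexField.Normc.normcM. Qed.

Lemma cabsV z : cabs z^-1 = (cabs z)^-1.
Proof. exact: ComplexField.Normc.normcV. Qed.

Lemma cabsX z n : cabs (z ^+ n) = cabs z ^+ n.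
Proof.
elim: n => [|n IH]; first by rewrite !expr0; exact: ComplexField.Normc.normc1.
by rewrite !exprS cabsM IH.
Qed.

Lemma cabsN z : cabs (- z) = cabs z.
Proof. by rewrite !cabsE; case: z => a b /=; rewrite !sqrrN. Qed.

Lemma cabsD z w : cabs (z + w) <= cabs z + cabs w.
Proof. exact: le_normcD. Qed.

Lemma cabsB z w : cabs (z - w) <= cabs z + cabs w.
Proof. by rewrite -[cabs w]cabsN; exact: cabsD. Qed.

Lemma cabs_eq0 z : (cabs z == 0) = (z == 0).
Proof.
apply/eqP/eqP => [/ComplexField.Normc.eq0_normc//|->].
exact: ComplexField.Normc.normc0.
Qed.

Lemma cabs_real x : 0 <= x -> cabs x%:C = x.
Proof. by move=> x0; rewrite cabsE /= expr0n addr0 sqrtr_sqr ger0_norm. Qed.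

Lemma cabs_nat n : cabs (n%:R : R[i]) = n%:R.
Proof. by rewrite -(rmorph_nat (real_complex R)) cabs_real. Qed.

Lemma le_Re_cabs z : `|complex.Re z| <= cabs z.
Proof.
by rewrite cabsE -sqrtr_sqr ler_wsqrtr// lerDl sqr_ge0.
Qed.

Lemma le_Im_cabs z : `|complex.Im z| <= cabs z.
Proof.
by rewrite cabsE -sqrtr_sqr ler_wsqrtr// lerDr sqr_ge0.
Qed.

Lemma cabs_le_ReIm z : cabs z <= `|complex.Re z| + `|complex.Im z|.
Proof.
case: z => a b; rewrite (_ : a +i* b = a%:C + 0 +i* b); last by simpc.
apply: le_trans (cabsD _ _) _.
by rewrite !cabsE /= expr0n/= addr0 add0r !sqrtr_sqr addr0 add0r.
Qed.

End complex_modulus.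

Section complex_convergence.
Variable R : realType.
Implicit Types (u v : nat -> R[i]) (a b : R[i]).

Lemma ccvgE u a : ccvg u a <-> (u : nat -> R[i]^o) @ \oo --> (a : R[i]^o).
Proof.
split=> [[/cvgrPdist_lt ur /cvgrPdist_lt ui]|/cvgrPdist_lt ua].
  apply/cvgrPdist_lt => -[e e'] /=; rewrite ltcE /= => /andP[/eqP -> e0].
  have e2 : 0 < e / 2 by rewrite divr_gt0.
  have := ui _ e2; have := ur _ e2; apply: filterS2 => n /= h1 h2.
  rewrite cabs_norm ltcR; apply: le_lt_trans (cabs_le_ReIm _ _) _.
  move: h1 h2; case: (u n) => ? ?; case: (a) => ? ? /=; lra.
split; apply/cvgrPdist_lt => e e0.
  have e0' : (0 : R[i]) < e%:C by rewrite ltcR.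
  have := ua _ e0'; apply: filterS => n /=.
  rewrite cabs_norm ltcR => /(le_lt_trans (le_Re_cabs _ _)).
  by case: (u n) => ? ?; case: (a) => ? ? /=.
have e0' : (0 : R[i]) < e%:C by rewrite ltcR.
have := ua _ e0'; apply: filterS => n /=.
rewrite cabs_norm ltcR => /(le_lt_trans (le_Im_cabs _ _)).
by case: (u n) => ? ?; case: (a) => ? ? /=.
Qed.

Lemma ccvg_cst a : ccvg (fun=> a) a.
Proof. by split; exact: cvg_cst. Qed.

Lemma ccvgD u v a b : ccvg u a -> ccvg v b ->
  ccvg (fun n => u n + v n) (a + b).
Proof. by move=> /ccvgE ua /ccvgE vb; apply/ccvgE; exact: (cvgD ua vb). Qed.

Lemma ccvgN u a : ccvg u a -> ccvg (fun n => - u n) (- a).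
Proof. by move=> /ccvgE ua; apply/ccvgE; exact: (cvgN ua). Qed.

Lemma ccvgM u v a b : ccvg u a -> ccvg v b ->
  ccvg (fun n => u n * v n) (a * b).
Proof. by move=> /ccvgE ua /ccvgE vb; apply/ccvgE; exact: (cvgM ua vb). Qed.

Lemma ccvgV u a : a != 0 -> ccvg u a -> ccvg (fun n => (u n)^-1) a^-1.
Proof. by move=> a0 /ccvgE ua; apply/ccvgE; exact: (cvgV a0 ua). Qed.

Lemma ccvg_unique u a b : ccvg u a -> ccvg u b -> a = b.
Proof.
case: a b => [a a'] [b b'] [/= ua ua'] [/= ub ub'].
by congr Complex; [exact: (cvg_unique _ ua ub)|exact: (cvg_unique _ ua' ub')].
Qed.

Lemma Re_series u n :
  complex.Re (series u n) = series (fun k => complex.Re (u k)) n.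
Proof.
rewrite /series /=; elim: n => [|n IH]; first by rewrite !big_nil.
by rewrite !big_nat_recr//= -IH ReD.
Qed.

Lemma Im_series u n :
  complex.Im (series u n) = series (fun k => complex.Im (u k)) n.
Proof.
rewrite /series /=; elim: n => [|n IH]; first by rewrite !big_nil.
by rewrite !big_nat_recr//= -IH ImD.
Qed.

Lemma ccvg_seriesP u a : ccvg (series u) a <->
  series (fun k => complex.Re (u k)) @ \oo --> complex.Re a /\
  series (fun k => complex.Im (u k)) @ \oo --> complex.Im a.
Proof.
rewrite /ccvg; under [in X in X /\ _]eq_fun do rewrite Re_series.
by under [in X in _ /\ X]eq_fun do rewrite Im_series.
Qed.

Lemma cseriesE u a : ccvg (series u) a -> cseries u = a.
Proof. by move=> /ccvgE ua; apply: (cvg_lim (@norm_hausdorff _ _) ua). Qed.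

Lemma ccvg_seriesD u v a b : ccvg (series u) a -> ccvg (series v) b ->
  ccvg (series (fun n => u n + v n)) (a + b).
Proof.
move=> ua vb; rewrite (_ : series _ = fun n => series u n + series v n).
  exact: ccvgD.
by apply/funext => n; rewrite /series /= big_split.
Qed.

Lemma ccvg_seriesM u a b : ccvg (series u) a ->
  ccvg (series (fun n => b * u n)) (b * a).
Proof.
move=> ua; rewrite (_ : series _ = fun n => b * series u n).
  by apply: ccvgM => //; exact: ccvg_cst.
by apply/funext => n; rewrite /series /= mulr_sumr.
Qed.

Lemma ctannery (F : nat -> nat -> R[i]) (Phi s : nat -> R[i]) (h : nat -> R) :
  cvgn (series h) -> (forall n k, cabs (F n k) <= h k) ->
  (forall k, ccvg (F ^~ k) (Phi k)) ->
  (forall n, ccvg (series (F n)) (s n)) ->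
  exists L, ccvg (series Phi) L /\ ccvg s L.
Proof.
move=> ch Fh FPhi Fs.
have [|||a [a1 a2]] := @tannery R (fun n k => complex.Re (F n k))
  (fun k => complex.Re (Phi k)) h (fun n => complex.Re (s n)) ch.
- by move=> n k; apply: le_trans (le_Re_cabs _ _) (Fh n k).
- by move=> k; have [] := FPhi k.
- by move=> n; have /ccvg_seriesP[] := Fs n.
have [|||b [b1 b2]] := @tannery R (fun n k => complex.Im (F n k))
  (fun k => complex.Im (Phi k)) h (fun n => complex.Im (s n)) ch.
- by move=> n k; apply: le_trans (le_Im_cabs _ _) (Fh n k).
- by move=> k; have [] := FPhi k.
- by move=> n; have /ccvg_seriesP[] := Fs n.
by exists (a +i* b); split; [apply/ccvg_seriesP|].
Qed.

Lemma cseries_exchange (f : nat -> nat -> R[i]) (g h : nat -> R)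
    (r c : nat -> R[i]) :
  cvgn (series g) -> cvgn (series h) ->
  (forall n, 0 <= g n) -> (forall k, 0 <= h k) ->
  (forall n k, cabs (f n k) <= g n * h k) ->
  (forall n, ccvg (series (f n)) (r n)) ->
  (forall k, ccvg (series (f ^~ k)) (c k)) ->
  exists S, ccvg (series r) S /\ ccvg (series c) S.
Proof.
move=> cg ch g0 h0 fgh fr fc.
have [|||a [a1 a2]] := @series_exchange R (fun n k => complex.Re (f n k)) g h
  (fun n => complex.Re (r n)) (fun n => complex.Re (c n)) cg ch g0 h0.
- by move=> n k; apply: le_trans (le_Re_cabs _ _) (fgh n k).
- by move=> n; have /ccvg_seriesP[] := fr n.
- by move=> n; have /ccvg_seriesP[] := fc n.
have [|||b [b1 b2]] := @series_exchange R (fun n k => complex.Im (f n k)) g h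
  (fun n => complex.Im (r n)) (fun n => complex.Im (c n)) cg ch g0 h0.
- by move=> n k; apply: le_trans (le_Im_cabs _ _) (fgh n k).
- by move=> n; have /ccvg_seriesP[] := fr n.
- by move=> n; have /ccvg_seriesP[] := fc n.
by exists (a +i* b); split; apply/ccvg_seriesP.
Qed.

End complex_convergence.

(** * Sums over roots of unity *)

Section roots_of_unity.
Variables (K : fieldType) (N : nat) (z v : K).
Hypothesis zN : z ^+ N = 1.
Hypothesis z_primitive : forall j, (0 < j < N)%N -> z ^+ j != 1.
Hypothesis vN : v ^+ N != 1.

Let X i := v * z ^+ i.

Let XN i : X i ^+ N = v ^+ N.
Proof. by rewrite exprMn exprAC zN expr1n mulr1. Qed.

Let X1 i : 1 - X i != 0.
Proof.
by apply: contra vN; rewrite subr_eq0 => /eqP X1; rewrite -(XN i) -X1 expr1n.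
Qed.

Let w1 : 1 - v ^+ N != 0.
Proof. by rewrite subr_eq0 eq_sym. Qed.

Let N_gt0 : (0 < N)%N.
Proof. by move: vN; case: (N) => //; rewrite expr0 eqxx. Qed.

Lemma sum_root_unity j : (0 < j < N)%N -> \sum_(i < N) z ^+ i ^+ j = 0.
Proof.
move=> /z_primitive zj; apply: (@mulfI _ (z ^+ j - 1)).
  by rewrite subr_eq0.
rewrite mulr0; under eq_bigr do rewrite exprAC.
by rewrite -subrX1 exprAC zN expr1n subrr.
Qed.

(** For [0 < j < N] the powers [z ^+ (i * j)] add up to zero, so only [j = 0]
    contributes. *)
Lemma sum_root_unityM (c : nat -> K) :
  \sum_(i < N) \sum_(j < N) c j * X i ^+ j = N%:R * c 0.
Proof.
rewrite exchange_big /=; have -> : N%:R * c 0 =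
    \sum_(j < N) if j == Ordinal N_gt0 then N%:R * c 0 else 0.
  by rewrite -big_mkcond big_pred1_eq.
apply: eq_bigr => j _; under eq_bigr do rewrite exprMn mulrA.
rewrite -mulr_sumr; case: eqP => [->/=|/eqP j0].
  rewrite expr0 mulr1 mulrC; congr (_ * _).
  by under eq_bigr do rewrite expr0; rewrite sumr_const card_ord.
rewrite sum_root_unity ?mulr0//; move: j0; rewrite -val_eqE /= ltn_ord andbT.
by rewrite lt0n.
Qed.

(** Each [X i] has the same [N]-th power, so [1 / (1 - X i)] is a geometric sum
    divided by [1 - v ^+ N], a polynomial in [X i] of degree less than [N]. This
    is the multiplication formula of the cotangent, freed of trigonometry. *)
Lemma sum_root_unity_inv :
  \sum_(i < N) (1 - X i)^-1 = N%:R / (1 - v ^+ N).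
Proof.
have -> : N%:R / (1 - v ^+ N) =
    \sum_(i < N) \sum_(j < N) (1 - v ^+ N)^-1 * X i ^+ j.
  by rewrite (sum_root_unityM (fun=> _)).
apply: eq_bigr => i _; rewrite -mulr_sumr; apply: (@mulIf _ (1 - X i)) => //.
rewrite mulVf// -mulrA [_ * (1 - X i)]mulrC -(opprB (X i)) mulNr -subrX1 XN.
by rewrite opprB mulVf.
Qed.

(** [(1 - v ^+ N) * X i / (1 - X i) ^+ 2] is the sum of
    [N%:R * v ^+ N / (1 - X i)] and of [J i], a polynomial of degree less than [N]
    without constant term, which does not contribute. *)
Lemma sum_root_unity_sqr_inv :
  \sum_(i < N) X i / (1 - X i) ^+ 2 = N%:R ^+ 2 * (v ^+ N / (1 - v ^+ N) ^+ 2).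
Proof.
pose J i := \sum_(j < N) j%:R * X i ^+ j.
have JE i : X i / (1 - X i) ^+ 2 =
    (1 - v ^+ N)^-1 * (J i + N%:R * v ^+ N * (1 - X i)^-1).
  suff h n : (1 - X i) ^+ 2 * (\sum_(j < n.+1) j%:R * X i ^+ j) =
    X i * (1 - X i ^+ n.+1) - n.+1%:R * X i ^+ n.+1 * (1 - X i).
    have := h N.-1; rewrite prednK// XN -/(J i) => hJ.
    have -> : J i = (X i * (1 - v ^+ N) - N%:R * v ^+ N * (1 - X i)) /
        (1 - X i) ^+ 2.
      by rewrite -hJ mulrC mulKf// expf_neq0.
    by move: (X1 i) w1 => ? ?; field; apply/andP; split.
  elim: n => [|n IH]; first by rewrite big_ord1 mul0r expr1; ring.
  by rewrite big_ord_recr /= mulrDr IH -!natr1 [X i ^+ n.+2]exprS; ring.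
under eq_bigr do rewrite JE.
rewrite -mulr_sumr big_split /= (sum_root_unityM (fun j => j%:R)) mulr0 add0r.
by rewrite -mulr_sumr sum_root_unity_inv; field.
Qed.

End roots_of_unity.

(** * Geometric series and the complex exponential *)

Section power_series.
Variable R : realType.
Implicit Types (r : R) (w z : R[i]).

(** With [r = s ^+ 2], [n * s ^+ n] stays below the sum of the geometric series
    of ratio [s], and the other factor [s ^+ n] goes to zero. *)
Lemma cvg_natrM_expr r : 0 <= r < 1 -> (fun n => n%:R * r ^+ n) @ \oo --> (0 : R).
Proof.
move=> /andP[r0 r1].
pose s := Num.sqrt r.
have s0 : 0 <= s by exact: sqrtr_ge0.
have s1 : s < 1 by rewrite -(@sqrtr1 R) ltr_sqrt.
have rE n : r ^+ n = s ^+ n * s ^+ n by rewrite -exprMn -expr2 sqr_sqrtr.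
have bound n : n%:R * s ^+ n <= (1 - s)^-1.
  have d0 : 0 < 1 - s by rewrite subr_gt0.
  apply: (@le_trans _ _ (\sum_(i < n) s ^+ i)).
    rewrite mulr_natl -[X in _ *+ X]card_ord -sumr_const.
    by apply: ler_sum => i _; apply: ler_wiXn2l => //; [exact: ltW | exact: ltnW].
  rewrite -[leRHS]mul1r ler_pdivlMr// mulrC -opprB mulNr -subrX1 opprB.
  by rewrite gerBl exprn_ge0.
have c0 : (fun n => (1 - s)^-1 * s ^+ n) @ \oo --> (0 : R).
  by rewrite -[X in _ --> X](mulr0 (1 - s)^-1); apply: cvgMl_tmp;
    apply: cvg_expr; rewrite ger0_norm.
apply: (squeeze_cvgr _ (cvg_cst 0) c0); near=> n.
by rewrite rE mulrA mulr_ge0 ?mulr_ge0 ?exprn_ge0//= ler_wpM2r ?exprn_ge0.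
Unshelve. all: by end_near. Qed.

Lemma ccvg0 (u : nat -> R[i]) :
  (fun n => cabs (u n)) @ \oo --> (0 : R) -> ccvg u 0.
Proof.
move=> /cvgrPdist_lt u0; split; apply/cvgrPdist_lt => e /u0;
  apply: filterS => n; rewrite !sub0r !normrN ger0_norm ?cabs_ge0//.
  by apply: le_lt_trans; exact: le_Re_cabs.
by apply: le_lt_trans; exact: le_Im_cabs.
Qed.

Lemma cabs1B_neq0 w : cabs w < 1 -> 1 - w != 0.
Proof.
apply: contraTneq => /eqP; rewrite subr_eq0 => /eqP <-.
by rewrite -leNgt (cabs_nat _ 1).
Qed.

Lemma ccvg_geometric w : cabs w < 1 ->
  ccvg (series (fun j => w ^+ j.+1)) (w / (1 - w)).
Proof.
move=> w1; have w0 := cabs1B_neq0 _ w1.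
have -> : series (fun j => w ^+ j.+1) =
    fun n => w / (1 - w) + - (w / (1 - w)) * w ^+ n.
  apply/funext; rewrite /series /=; elim=> [|n IH].
    by rewrite big_nil expr0 mulr1 subrr.
  by rewrite big_nat_recr//= IH !exprS; field.
rewrite -[X in ccvg _ X]addr0 -[X in ccvg _ (_ + X)](mulr0 (- (w / (1 - w)))).
apply: ccvgD; first exact: ccvg_cst.
apply: ccvgM; first exact: ccvg_cst.
apply: ccvg0; under eq_fun do rewrite cabsX.
by apply: cvg_expr; rewrite ger0_norm ?cabs_ge0.
Qed.

Lemma ccvg_arith_geometric w : cabs w < 1 ->
  ccvg (series (fun j => j.+1%:R * w ^+ j.+1)) (w / (1 - w) ^+ 2).
Proof.
move=> w1; have w0 := cabs1B_neq0 _ w1.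
have -> : series (fun j => j.+1%:R * w ^+ j.+1) =
    fun n => w / (1 - w) ^+ 2 +
      (- (w / (1 - w) ^+ 2) * w ^+ n + - (w / (1 - w)) * (n%:R * w ^+ n)).
  apply/funext; rewrite /series /=; elim=> [|n IH].
    by rewrite big_nil expr0 !mulr1 mulr0n mulr0 addr0 subrr.
  by rewrite big_nat_recr//= IH !exprS -natr1; field.
rewrite -[X in ccvg _ X]addr0 -[X in ccvg _ (_ + X)]addr0.
apply: ccvgD; first exact: ccvg_cst.
rewrite -[X in ccvg _ (X + _)](mulr0 (- (w / (1 - w) ^+ 2))).
rewrite -[X in ccvg _ (_ + X)](mulr0 (- (w / (1 - w)))).
apply: ccvgD; apply: ccvgM; try exact: ccvg_cst.
  apply: ccvg0; under eq_fun do rewrite cabsX.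
  by apply: cvg_expr; rewrite ger0_norm ?cabs_ge0.
apply: ccvg0; under eq_fun do rewrite cabsM cabs_nat cabsX.
by apply: cvg_natrM_expr; rewrite cabs_ge0.
Qed.

Lemma cvg_series_arith_geometric r : 0 <= r < 1 ->
  cvgn (series (fun j => j.+1%:R * r ^+ j.+1)).
Proof.
move=> /andP[r0 r1]; have := ccvg_arith_geometric r%:C.
rewrite cabs_real// => /(_ r1) /ccvg_seriesP[+ _].
rewrite (_ : (fun k => _) = fun j => j.+1%:R * r ^+ j.+1); first exact: cvgP.
apply/funext => j; rewrite -(rmorph_nat (real_complex R)).
by rewrite -(rmorphXn (real_complex R)) -(rmorphM (real_complex R)).
Qed.

Lemma cvg_series_geometric r : 0 <= r < 1 -> cvgn (series (fun j => r ^+ j.+1)).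
Proof.
move=> /andP[r0 r1]; have := ccvg_geometric r%:C.
rewrite cabs_real// => /(_ r1) /ccvg_seriesP[+ _].
rewrite (_ : (fun k => _) = fun j => r ^+ j.+1); first exact: cvgP.
by apply/funext => j; rewrite -(rmorphXn (real_complex R)).
Qed.

End power_series.

Section complex_exponential.
Variable R : realType.
Implicit Types (z w : R[i]) (a b : R).

Lemma cexpE a b : cexp (a +i* b) = (expR a * cos b) +i* (expR a * sin b).
Proof. by rewrite /cexp /=; simpc. Qed.

Lemma cexp0 : cexp (0 : R[i]) = 1.
Proof. by rewrite (cexpE 0 0) expR0 cos0 sin0 mul1r mulr0. Qed.

Lemma cexpD z w : cexp (z + w) = cexp z * cexp w.
Proof.
case: z w => [a b] [c d]; rewrite !cexpE; simpc.
by rewrite expRD cosD sinD; congr Complex; ring.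
Qed.

Lemma cexpMn z n : cexp (n%:R * z) = cexp z ^+ n.
Proof.
elim: n => [|n IH]; first by rewrite mul0r cexp0 expr0.
by rewrite -natr1 mulrDl mul1r cexpD IH exprSr.
Qed.

Lemma cexpN z : cexp (- z) = (cexp z)^-1.
Proof.
have e : cexp z * cexp (- z) = 1 by rewrite -cexpD subrr cexp0.
have z0 : cexp z != 0.
  by apply/eqP => z0; move: e; rewrite z0 mul0r => /esym/eqP; rewrite oner_eq0.
by apply: (mulfI z0); rewrite e divff.
Qed.

Lemma cabs_cexp z : cabs (cexp z) = expR (complex.Re z).
Proof.
case: z => a b; rewrite cexpE cabsE /= !exprMn -mulrDr cos2Dsin2 mulr1.
by rewrite sqrtr_sqr ger0_norm ?expR_ge0.
Qed.

Lemma is_derive_cvg_harmonic (f : R -> R) (d : R) : is_derive (0 : R) (1 : R) f d ->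
  (fun n => n.+1%:R * (f n.+1%:R^-1 - f 0)) @ \oo --> d.
Proof.
move=> [fd <-].
have h0 : (fun n => n.+1%:R^-1 : R) @ \oo --> (0 : R)^'.
  move=> A /= [e e0 eA]; have [N _ HN] :=
    (cvgrPdist_lt _ _).1 (@cvg_harmonic R) _ e0.
  exists N => // n /HN /= h; apply: eA => /=; first exact: h.
  by rewrite invr_eq0 pnatr_eq0.
have := cvg_comp _ _ h0 fd; apply: cvg_trans; apply: near_eq_cvg.
apply: nearW => n /=; rewrite invrK addr0 /GRing.scale /=.
by rewrite mulr1.
Qed.

(** The derivative of [exp] at 0, along the sequence [1 / n]; every termwise
    limit in the partial fraction expansions below comes from it. *)
Lemma ccvg_cexp_sub1 z :
  ccvg (fun n => n.+1%:R * (cexp (z / n.+1%:R) - 1)) z.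
Proof.
case: z => a b.
have E n : n.+1%:R * (cexp ((a +i* b) / n.+1%:R) - 1) =
  (n.+1%:R * (expR (a * n.+1%:R^-1) * cos (b * n.+1%:R^-1) - 1)) +i*
  (n.+1%:R * (expR (a * n.+1%:R^-1) * sin (b * n.+1%:R^-1))).
  rewrite -(rmorph_nat (real_complex R)) -fmorphV/=.
  have -> : (a +i* b) * (n.+1%:R^-1)%:C = (a * n.+1%:R^-1) +i* (b * n.+1%:R^-1).
    by simpc.
  by rewrite cexpE; simpc.
rewrite /ccvg; under [in X in X /\ _]eq_fun do rewrite E/=.
under [in X in _ /\ X]eq_fun do rewrite E/=.
have := @is_derive_cvg_harmonic (fun t => expR (a * t) * cos (b * t)) a.
have := @is_derive_cvg_harmonic (fun t => expR (a * t) * sin (b * t)) b.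
rewrite /= !mulr0 expR0 cos0 sin0 mulr0 mulr1 => h1 h2; split => /=.
  apply: h2; apply: is_derive_eq; rewrite /GRing.scale /=.
  by rewrite !mulr0 expR0 sin0 cos0; ring.
under eq_fun do rewrite -[X in _ * X]subr0.
apply: h1; apply: is_derive_eq; rewrite /GRing.scale /=.
by rewrite !mulr0 expR0 sin0 cos0; ring.
Qed.

End complex_exponential.

(** * Elementary real estimates *)

Section real_inequalities.
Variable R : realType.
Implicit Types (f df : R -> R) (t x : R).

Lemma le_nondecreasing_derive f df x :
  (forall t, is_derive t (1 : R) f (df t)) ->
  (forall t, 0 <= t <= x -> 0 <= df t) -> 0 <= x -> f 0 <= f x.
Proof.
move=> fdf df0; rewrite le_eqVlt => /predU1P[<-//|x0].
have cf : {within `[0, x], continuous f}.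
  by apply: derivable_within_continuous => t _; have [] := fdf t.
have [c cx e] := MVT x0 (fun t _ => fdf t) cf.
rewrite -subr_ge0 e mulr_ge0 ?subr0 ?(ltW x0)// df0//.
by move: cx; rewrite in_itv /= => /andP[/ltW -> /ltW ->].
Qed.

(** With [s = t / 2], [sin t = 2 sin s cos s] and [s cos s <= sin s], hence
    [sin t >= t (1 + cos t) / 2]. *)
Lemma half_le_sin t : 0 <= t <= pi / 2 -> t / 2 <= sin t.
Proof.
move=> /andP[t0 tpi]; have pi2 := pi_ge2 R.
have c0 : 0 <= cos t by apply: cos_ge0_pihalf; rewrite tpi andbT; lra.
have s0 : 0 <= t / 2 by lra.
have h : t / 2 * cos (t / 2) <= sin (t / 2).
  rewrite -subr_ge0.
  have := @le_nondecreasing_derive (fun u => sin u - u * cos u)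
    (fun u => u * sin u) (t / 2).
  rewrite mul0r sin0 subr0; apply => //.
    by move=> u; apply: is_derive_eq; rewrite /GRing.scale /=; ring.
  move=> u /andP[u0 ut]; rewrite mulr_ge0// sin_ge0_pi// u0 /=; lra.
have d : t = (t / 2) *+ 2 by rewrite mulr2n -splitr.
have c2 : 0 <= cos (t / 2).
  by apply: cos_ge0_pihalf; apply/andP; split; lra.
rewrite [in leRHS]d sin_mulr2n.
have := cos_mulr2n (t / 2); rewrite -d => cE.
apply: (@le_trans _ _ (t / 2 * cos (t / 2) * cos (t / 2) *+ 2)).
  by have := mulr_ge0 s0 c0; rewrite cE; lra.
by rewrite [cos _ * sin _]mulrC; move: (ler_wpM2r c2 h); lra.
Qed.

End real_inequalities.

Section summability.
Variable R : realType.

Lemma cvg_series_invn2 : cvgn (series (fun n => n.+1%:R ^- 2 : R)).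
Proof.
have tel n : series (fun n => (n.+1%:R * n.+2%:R)^-1 : R) n = 1 - n.+1%:R^-1.
  rewrite /series /=; elim: n => [|n IH]; first by rewrite big_nil invr1 subrr.
  rewrite big_nat_recr//= IH -(natr1 n.+1).
  have n0 : 0 < n.+1%:R :> R by [].
  by field; rewrite !gt_eqF//; lra.
have ct : cvgn (series (fun n => (n.+1%:R * n.+2%:R)^-1 : R)).
  apply/cvg_ex; exists (1 - 0).
  rewrite (_ : series _ = fun n => 1 - n.+1%:R^-1); last exact/funext.
  by apply: cvgB; [exact: cvg_cst|exact: cvg_harmonic].
have := cvgP _ (cvg_seriesM _ _ 2 _ ct); apply: series_le_cvg => n.
- by rewrite invr_ge0 exprn_ge0.
- by rewrite mulr_ge0// invr_ge0 mulr_ge0.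
- have n0 : 1 <= n.+1%:R :> R by rewrite ler1n.
  rewrite -(natr1 n.+1) -[2]invrK -invfM lef_pV2 ?posrE ?mulr_gt0 ?exprn_gt0//; nra.
Qed.

End summability.

(** * Symmetric sums and the function exp (2 i pi z) *)

Section symmetric_sums.

Lemma sum_symmetric (V : zmodType) (f : int -> V) K :
  \sum_(i < K.*2.+1) f (i%:Z - K%:Z) =
  f 0 + \sum_(0 <= k < K) (f k.+1%:Z + f (- k.+1%:Z)).
Proof.
elim: K => [|K IH]; first by rewrite big_ord1 big_nil !addr0.
rewrite doubleS big_ord_recl big_ord_recr /= big_nat_recr//= [in RHS]addrA -IH.
rewrite [in LHS]addrCA; congr (_ + _); last first.
  by rewrite [LHS]addrC; congr (f _ + f _); rewrite /bump /=; lia.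
by apply: eq_bigr => i _; congr f; rewrite /bump /=; lia.
Qed.

End symmetric_sums.

Section nome.
Variable R : realType.
Implicit Types (z w : R[i]) (a b : R).

(** The local parameter of the half plane at the cusp. *)
Definition nome z : R[i] := cexp ((2 * pi)%:C * 'i%C * z).

Lemma nomeE a b : nome (a +i* b) =
  (expR (- (2 * pi * b)) * cos (2 * pi * a)) +i*
  (expR (- (2 * pi * b)) * sin (2 * pi * a)).
Proof.
rewrite /nome (_ : (2 * pi)%:C * 'i%C * (a +i* b) =
  (- (2 * pi * b)) +i* (2 * pi * a)) ?cexpE//.
by simpc.
Qed.

Lemma nomeD z w : nome (z + w) = nome z * nome w.
Proof. by rewrite /nome mulrDr cexpD. Qed.

Lemma nomeMn z n : nome (n%:R * z) = nome z ^+ n.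
Proof. by rewrite /nome -cexpMn; congr cexp; ring. Qed.

Lemma cabs_nome z : cabs (nome z) = expR (- (2 * pi * complex.Im z)).
Proof. by case: z => a b; rewrite /nome cabs_cexp; simpc. Qed.

Lemma nome1 : nome 1 = 1.
Proof.
rewrite -[1 in LHS]/(1 +i* 0) (nomeE 1 0) !mulr0 oppr0 expR0 !mul1r !mulr1.
by rewrite mulr_natl cos2pi sin2pi.
Qed.

Lemma nome_nat n : nome n%:R = 1.
Proof. by rewrite -[n%:R]mulr1 nomeMn nome1 expr1n. Qed.

Lemma nomeN z : nome (- z) = (nome z)^-1.
Proof. by rewrite /nome mulrN cexpN. Qed.

Lemma nome_int (m : int) : nome m%:~R = 1.
Proof.
by case: m => n; rewrite ?NegzE ?mulrNz ?nomeN -?pmulrn nome_nat ?invr1.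
Qed.

Lemma cabs_nome_lt1 z : 0 < complex.Im z -> cabs (nome z) < 1.
Proof.
by move=> z0; rewrite cabs_nome expR_lt1 oppr_lt0 !mulr_gt0// pi_gt0.
Qed.

(** With [t = pi * a], [(1 - cos (2 t)) ^+ 2 + sin (2 t) ^+ 2 = 4 sin t ^+ 2]. *)
Lemma cabs_1B_nome_real a :
  cabs (1 - nome a%:C) = 2 * `|sin (pi * a)|.
Proof.
rewrite (nomeE a 0) mulr0 oppr0 expR0 !mul1r cabsE /=.
have -> : 2 * pi * a = (pi * a) *+ 2 by rewrite mulr2n; ring.
have e : (1 - cos ((pi * a) *+ 2)) ^+ 2 + (0 - sin ((pi * a) *+ 2)) ^+ 2 =
    (2 * sin (pi * a)) ^+ 2.
  rewrite cos_mulr2n sin_mulr2n.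
  have := cos2sin2 (pi * a); set c := cos _; set s := sin _ => cs.
  have -> : (c ^+ 2 *+ 2 - 1) = 1 - s ^+ 2 *+ 2 by rewrite cs; ring.
  have -> : (0 - (c * s) *+ 2) ^+ 2 = 4 * c ^+ 2 * s ^+ 2 by ring.
  by rewrite cs; ring.
by rewrite e sqrtr_sqr normrM ger0_norm.
Qed.

End nome.

Arguments nome {R}.

(** * Partial fraction expansions of cot and of 1/sin^2 *)

Section cotangent.
Variable R : realType.
Implicit Types (z w : R[i]) (a b : R).

Definition csymmetric_partial_sum (f : int -> R[i]) (K : nat) : R[i] :=
  \sum_(i < K.*2.+1) f (i%:Z - K%:Z).

(** A symmetric sum need not converge absolutely: domination is only asked of the
    pairs [k], [-k]. The range of summation grows with the index [M] of the
    approximating terms [g M]. *)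
Lemma symmetric_tannery (g : nat -> int -> R[i]) (phi : int -> R[i])
    (h : nat -> R) (L : R[i]) :
  cvgn (series h) ->
  (forall M k, (k < M)%N -> cabs (g M k.+1%:Z + g M (- k.+1%:Z)) <= h k) ->
  (forall k, ccvg (g ^~ k) (phi k)) ->
  ccvg (fun M => csymmetric_partial_sum (g M) M) L ->
  ccvg (csymmetric_partial_sum phi) L.
Proof.
move=> ch gh gphi gL.
have h0 k : 0 <= h k by apply: le_trans (gh k.+1 k (leqnn _)); exact: cabs_ge0.
(* Beyond the range of summation the approximating terms are cut to zero. *)
pose F (M k : nat) : R[i] := if (k < M)%N then g M k.+1%:Z + g M (- k.+1%:Z) else 0.
have [||M|S [S1 S2]] := @ctannery R F
  (fun k => phi k.+1%:Z + phi (- k.+1%:Z))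
  (fun M => csymmetric_partial_sum (g M) M - g M 0) h ch.
- move=> M k; rewrite /F; case: ifP => [/gh//|_].
  by rewrite (cabs_nat _ 0).
- move=> k; have := ccvgD _ _ _ _ _ (gphi k.+1%:Z) (gphi (- k.+1%:Z)).
  move=> /ccvgE H; apply/ccvgE; apply: cvg_trans H; apply: near_eq_cvg.
  by exists k.+1 => // M /= kM; rewrite /F kM.
- have E m : (M <= m)%N ->
      series (F M) m = csymmetric_partial_sum (g M) M - g M 0.
    move=> Mm; rewrite /csymmetric_partial_sum sum_symmetric addrAC subrr add0r.
    rewrite /series /= (big_cat_nat _ Mm)//= [X in _ + X]big_nat_cond.
    rewrite [X in _ + X]big1 ?addr0; last first.
      by move=> i /andP[/andP[Mi _] _]; rewrite /F ltnNge Mi.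
    by apply: eq_big_nat => i /andP[_ iM]; rewrite /F iM.
  by apply/ccvgE; apply: cvg_near_cst; exists M => // m /= Mm; rewrite E.
have -> : L = phi 0 + S.
  have := ccvgD _ _ _ _ _ gL (ccvgN _ _ _ (gphi 0)) => S3.
  by rewrite (ccvg_unique _ _ _ _ S2 S3); ring.
rewrite (_ : csymmetric_partial_sum phi = fun K => phi 0 +
    series (fun k => phi k.+1%:Z + phi (- k.+1%:Z)) K).
  by apply: ccvgD => //; exact: ccvg_cst.
by apply/funext => K; rewrite /csymmetric_partial_sum sum_symmetric.
Qed.

Section residue_sums.
Variables (z : R[i]) (M : nat).
Hypothesis z_gt0 : 0 < complex.Im z.
Let N := M.*2.+1.

Lemma nome_unit : nome z != 1.
Proof.
apply/eqP => z1; have := cabs_nome_lt1 _ _ z_gt0.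
by rewrite z1 (cabs_nat _ 1) ltxx.
Qed.

Let NC : (N%:R : R[i]) != 0. Proof. by rewrite pnatr_eq0. Qed.

Let rootN : nome (N%:R^-1 : R[i]) ^+ N = 1.
Proof. by rewrite -nomeMn mulfV// nome1. Qed.

Let root_primitive j : (0 < j < N)%N -> nome (N%:R^-1 : R[i]) ^+ j != 1.
Proof.
move=> /andP[j0 jN]; rewrite -nomeMn eq_sym -subr_eq0 -cabs_eq0.
have -> : j%:R / N%:R = (j%:R / N%:R : R)%:C.
  by rewrite fmorph_div !rmorph_nat.
rewrite cabs_1B_nome_real mulf_neq0// normr_eq0 gt_eqF// sin_gt0_pi//.
rewrite mulr_gt0 ?pi_gt0 ?divr_gt0 ?ltr0n//= -[ltRHS]mulr1.
by rewrite ltr_pM2l ?pi_gt0// ltr_pdivrMr ?ltr0n// mul1r ltr_nat.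
Qed.

Let shifted (G : R[i] -> R[i]) :
  csymmetric_partial_sum (fun k => G (nome ((z + k%:~R) / N%:R))) M =
  \sum_(i < N) G (nome ((z - M%:R) / N%:R) * nome (N%:R^-1 : R[i]) ^+ i).
Proof.
apply: eq_bigr => i _; congr G; rewrite -nomeMn -nomeD; congr (nome _).
by rewrite intrB -!pmulrn; field.
Qed.

Let baseN : nome ((z - M%:R) / N%:R) ^+ N = nome z.
Proof.
rewrite -nomeMn mulrC divfK// nomeD -[- M%:R]mulr1 mulNr -mulrN.
by rewrite nomeMn nomeN nome1 invr1 expr1n mulr1.
Qed.

(** For [N = 2 M + 1] the residues [-M .. M] run once through the [N]-th roots of
    unity, up to a rotation which does not change the [N]-th power. *)
Lemma csym_inv_1B_nome :
  csymmetric_partial_sum (fun k => (1 - nome ((z + k%:~R) / N%:R))^-1) M =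
  N%:R / (1 - nome z).
Proof.
rewrite (shifted (fun X => (1 - X)^-1)) -[in RHS]baseN.
by apply: sum_root_unity_inv; rewrite // baseN nome_unit.
Qed.

Lemma csym_sqr_inv_1B_nome :
  csymmetric_partial_sum (fun k => nome ((z + k%:~R) / N%:R) /
     (1 - nome ((z + k%:~R) / N%:R)) ^+ 2) M =
  N%:R ^+ 2 * (nome z / (1 - nome z) ^+ 2).
Proof.
rewrite (shifted (fun X => X / (1 - X) ^+ 2)) -[in RHS]baseN.
by apply: sum_root_unity_sqr_inv; rewrite // baseN nome_unit.
Qed.

End residue_sums.

Lemma ccvg_1B_nome z : exists2 C, 0 < C &
  forall n, cabs (1 - nome (z / n.+1%:R)) <= C / n.+1%:R.
Proof.
have := ccvg_cexp_sub1 _ ((2 * pi)%:C * 'i%C * z).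
move=> [/cvgP/cvg_seq_bounded/pinfty_ex_gt0[A A0 hA]
        /cvgP/cvg_seq_bounded/pinfty_ex_gt0[B B0 hB]].
exists (A + B); first exact: addr_gt0.
move=> n; rewrite ler_pdivlMr// mulrC -(cabs_nat _ n.+1) -cabsM.
rewrite -opprB mulrN cabsN /nome mulrA; apply: le_trans (cabs_le_ReIm _ _) _.
by apply: lerD; [exact: hA|exact: hB].
Qed.

Lemma one_sub_expRN_ge b n : 0 < b -> 1 <= n ->
  b / (1 + b) / n <= 1 - expR (- (b / n)) :> R.
Proof.
move=> b0 n1; have n0 : 0 < n by lra.
have p1 : 0 < 1 + b / n by rewrite addr_gt0// divr_gt0.
apply: (@le_trans _ _ (1 - (1 + b / n)^-1)); last first.
  by rewrite expRN lerB// lef_pV2 ?posrE ?expR_gt0// expR_ge1Dx.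
rewrite -subr_ge0.
rewrite (_ : _ - _ = b ^+ 2 * (n - 1) / (n * (1 + b) * (n + b))).
  by rewrite divr_ge0 ?mulr_ge0 ?sqr_ge0//; lra.
by field; rewrite !gt_eqF//; lra.
Qed.

(** The uniform lower bound which makes Tannery's theorem apply. For large [k],
    [1 - exp (2 i pi k / N)] dominates the correction due to [z], which is
    [O(1 / N)]; for the remaining [k], the positive imaginary part of [z] keeps
    the exponential at distance of order [1 / N] from the unit circle. *)
Lemma cabs_1B_nome_ge z : 0 < complex.Im z ->
  exists2 delta : R, 0 < delta & forall M (k : int), (`|k| <= M)%N ->
    delta * `|k|.+1%:R / M.*2.+1%:R <=
    cabs (1 - nome ((z + k%:~R) / M.*2.+1%:R)).
Proof.
move=> z0; have [C C0 hC] := ccvg_1B_nome z.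
have [B BE] : {B | B = 2 * pi * complex.Im z} by eexists.
have B0 : 0 < B by rewrite BE !mulr_gt0// pi_gt0.
pose c := B / (1 + B).
have c0 : 0 < c by rewrite divr_gt0// addr_gt0.
(* delta <= c / (C + 2) serves k <= C + 1, and delta <= 1 the other k. *)
pose delta := Num.min 1 (c / (C + 2)).
have d0 : 0 < delta by rewrite lt_min ltr01 divr_gt0// addr_gt0.
exists delta => // M k kM.
set N := M.*2.+1.
have N0 : 0 < N%:R :> R by [].
have NC : (N%:R : R[i]) != 0 by rewrite pnatr_eq0.
have ImE : complex.Im ((z + k%:~R) / N%:R) = complex.Im z / N%:R.
  case: (z) => a b; rewrite -(rmorph_nat (real_complex R)) -fmorphV/=.
  by rewrite -(rmorph_int (real_complex R)); simpc.
have lower1 : c / N%:R <= cabs (1 - nome ((z + k%:~R) / N%:R)).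
  have := cabsD _ (1 - nome ((z + k%:~R) / N%:R)) (nome ((z + k%:~R) / N%:R)).
  rewrite subrK (cabs_nat _ 1) -lerBlDr; apply: le_trans.
  by rewrite cabs_nome ImE mulrA -BE; apply: one_sub_expRN_ge; rewrite ?ler1n.
have lower2 : (2 * `|k|%N%:R - C) / N%:R <=
    cabs (1 - nome ((z + k%:~R) / N%:R)).
  have e : 1 - nome (k%:~R / N%:R) =
      (1 - nome ((z + k%:~R) / N%:R)) -
      nome (k%:~R / N%:R) * (1 - nome (z / N%:R)).
    by rewrite mulrDl nomeD; ring.
  have kE : k%:~R / N%:R = (k%:~R / N%:R : R)%:C.
    by rewrite fmorph_div rmorph_int rmorph_nat.
  have := cabsB _ (1 - nome ((z + k%:~R) / N%:R))
     (nome (k%:~R / N%:R) * (1 - nome (z / N%:R))).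
  have ck : cabs (nome (k%:~R / N%:R : R[i])) = 1 :> R.
    by rewrite kE cabs_nome /= mulr0 oppr0 expR0.
  rewrite -e cabsM ck mul1r -lerBlDr.
  apply: le_trans; rewrite mulrBl lerB//; last exact: hC.
  rewrite kE cabs_1B_nome_real -mulrA ler_wpM2l//.
  have kN : `|sin (pi * (k%:~R / N%:R))| = `|sin (pi * (`|k|%N%:R / N%:R))| :> R.
    rewrite natr_absz; case: (ler0P (k : int)) => // k0.
    by rewrite rmorphN /= mulNr mulrN sinN normrN.
  rewrite kN; apply: le_trans (ler_norm _).
  have kN2 : `|k|%N%:R / N%:R <= 1 / 2 :> R.
    rewrite ler_pdivrMr//; have : (`|k|%N%:R <= M%:R :> R) by rewrite ler_nat.
    have -> : N%:R = 2 * M%:R + 1 :> R.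
      by rewrite /N -addn1 -muln2 natrD natrM mulrC.
    by move=> ?; lra.
  have pi2 := pi_ge2 R.
  have k0 : 0 <= `|k|%N%:R / N%:R :> R by rewrite divr_ge0.
  apply: le_trans (half_le_sin _ _ _); first by nra.
  by apply/andP; split; nra.
rewrite mulrAC; have [kC|kC] := lerP (`|k|%N%:R) (C + 1).
  apply: le_trans lower1; rewrite mulrAC ler_wpM2r ?invr_ge0//.
  apply: (@le_trans _ _ (c / (C + 2) * (C + 2))); last first.
    by rewrite divfK// gt_eqF// addr_gt0.
  rewrite ler_pM ?(ltW d0)//; first by rewrite ge_min lexx orbT.
  by rewrite -natr1; lra.
apply: le_trans lower2; rewrite mulrAC ler_wpM2r ?invr_ge0//.
have d1 : delta <= 1 by rewrite ge_min lexx.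
rewrite -natr1.
apply: (@le_trans _ _ (1 * (`|k|%N%:R + 1))); last lra.
by rewrite ler_wpM2r.
Qed.

End cotangent.

Arguments csymmetric_partial_sum {R}.

(** For [N = 2 M + 1], the exact identities [csym_inv_1B_nome] and
    [csym_sqr_inv_1B_nome] express the right-hand sides as symmetric sums whose
    terms tend to multiples of [1 / (z + k)] and [1 / (z + k) ^+ 2] when [M]
    grows; Tannery's theorem concludes. *)
Section eisenstein_series.
Variable R : realType.
Variable z : R[i].
Hypothesis z_gt0 : 0 < complex.Im z.

Let kappa : R[i] := (2 * pi)%:C * 'i%C.

Let kappa_neq0 : kappa != 0.
Proof.
rewrite mulf_neq0//.
  by rewrite eq_complex /= eqxx andbT mulf_neq0// gt_eqF// pi_gt0.
by rewrite eq_complex /= oner_eq0 andbF.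
Qed.

Let shift_neq0 (k : int) : z + k%:~R != 0.
Proof.
apply/eqP => zk; suff : complex.Im (z + k%:~R) = complex.Im z.
  by rewrite zk /= => z0; move: z_gt0; rewrite -z0 ltxx.
by rewrite ImD -(rmorph_int (real_complex R)) addr0.
Qed.

Let N M : R[i] := M.*2.+1%:R.
Let X M (k : int) := nome ((z + k%:~R) / N M).

Let N_neq0 M : N M != 0. Proof. by rewrite pnatr_eq0. Qed.

Let ccvg_invN : ccvg (fun M => (N M)^-1) 0.
Proof.
apply: ccvg0; under eq_fun do rewrite cabsV cabs_nat.
have dbl : (fun M => M.*2) @ \oo --> \oo.
  move=> A [n _ nA]; exists n => // m /= nm; apply: nA => /=.
  by rewrite (leq_trans nm)// -addnn leq_addr.
exact: cvg_comp dbl (@cvg_harmonic R).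
Qed.

Let ccvg_N1BX k : ccvg (fun M => N M * (1 - X M k)) (- (kappa * (z + k%:~R))).
Proof.
have [c1 c2] := ccvg_cexp_sub1 _ (kappa * (z + k%:~R)).
have dbl : (fun M => M.*2) @ \oo --> \oo.
  move=> A [n _ nA]; exists n => // m /= nm; apply: nA => /=.
  by rewrite (leq_trans nm)// -addnn leq_addr.
have c : ccvg (fun M => N M * (X M k - 1)) (kappa * (z + k%:~R)).
  rewrite /X /nome; under eq_fun do rewrite mulrA.
  by split; [exact: cvg_comp dbl c1|exact: cvg_comp dbl c2].
by under eq_fun do rewrite -opprB mulrN; exact: ccvgN.
Qed.

Let ccvg_X k : ccvg (X ^~ k) 1.
Proof.
have := ccvgD _ _ _ _ _ (ccvg_cst _ 1)
  (ccvgN _ _ _ (ccvgM _ _ _ _ _ ccvg_invN (ccvg_N1BX k))).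
rewrite mul0r subr0; under eq_fun do rewrite mulKf// opprB addrC subrK.
by [].
Qed.

Let csymZ (f : int -> R[i]) c K :
  csymmetric_partial_sum (fun k => c * f k) K =
  c * csymmetric_partial_sum f K.
Proof. by rewrite /csymmetric_partial_sum mulr_sumr. Qed.

Let cvg_dominant (C : R) : cvgn (series (fun k => C * k.+1%:R ^- 2)).
Proof. exact: (cvgP _ (cvg_seriesM _ _ C _ (cvg_series_invn2 R))). Qed.

Let lower_bound : exists2 delta : R, 0 < delta & forall M (k : int),
  (`|k| <= M)%N -> (cabs (N M * (1 - X M k)))^-1 <= (delta * `|k|.+1%:R)^-1 /\
  1 - X M k != 0.
Proof.
have [d d0 hd] := cabs_1B_nome_ge _ _ z_gt0; exists d => // M k kM.
have p0 : 0 < d * `|k|.+1%:R by rewrite mulr_gt0.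
have := hd _ _ kM; rewrite ler_pdivrMr// [leRHS]mulrC => h.
have h' : d * `|k|.+1%:R <= cabs (N M * (1 - X M k)) by rewrite cabsM cabs_nat.
split.
  by rewrite lef_pV2 ?posrE //; exact: lt_le_trans p0 h'.
apply/eqP => X1; move: h'; rewrite X1 mulr0 (cabs_nat _ 0) => h'.
by move: (lt_le_trans p0 h'); rewrite ltxx.
Qed.

(** This is [pi * cot (pi * z)]. Two opposite terms combine into
    [(1 - XY) / ((1 - X) (1 - Y))], where [XY = exp (2 i pi z / N) ^+ 2] is
    independent of [k] and [1 - XY = O(1 / N)]: this gains the factor that makes
    the pairs dominated by [1 / k ^+ 2]. *)
Lemma eisenstein1 :
  ccvg (csymmetric_partial_sum (fun k => (z + k%:~R)^-1))
    (- ((2 * pi)%:C * 'i%C) * (1 / 2 + nome z / (1 - nome z))).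
Proof.
have w1 : 1 - nome z != 0 by exact: cabs1B_neq0 (cabs_nome_lt1 _ _ z_gt0).
have [d d0 hd] := lower_bound.
have [C C0 hC] := ccvg_1B_nome _ z.
pose g M (k : int) := (N M * (1 - X M k))^-1 - (N M)^-1 / 2.
have := @symmetric_tannery R g (fun k => (- (kappa * (z + k%:~R)))^-1)
  (fun k => (2 * C / d ^+ 2) * k.+1%:R ^- 2)
  (1 / 2 + nome z / (1 - nome z)) (cvg_dominant _).
have -> : csymmetric_partial_sum (fun k => (z + k%:~R)^-1) =
   fun K => - kappa *
     csymmetric_partial_sum (fun k => (- (kappa * (z + k%:~R)))^-1) K.
  apply/funext => K; rewrite -csymZ; congr csymmetric_partial_sum.
  apply/funext => k; have := shift_neq0 k; move: (z + _) kappa_neq0 => s ? ?.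
  by field; apply/andP.
move=> T; apply: ccvgM; first exact: ccvg_cst.
apply: T.
- move=> M k kM.
  have [h1 X1] := hd M k.+1%:Z kM.
  have [h2 X2] := hd M (- k.+1%:Z) kM.
  have -> : g M k.+1%:Z + g M (- k.+1%:Z) =
    (N M * (1 - X M k.+1%:Z))^-1 * (N M * (1 - X M (- k.+1%:Z)))^-1 *
    (N M * (1 - nome (z / N M))) * (1 + nome (z / N M)).
    have -> : (N M * (1 - X M k.+1%:Z))^-1 * (N M * (1 - X M (- k.+1%:Z)))^-1 *
      (N M * (1 - nome (z / N M))) * (1 + nome (z / N M)) =
      (N M * (1 - X M k.+1%:Z))^-1 * (N M * (1 - X M (- k.+1%:Z)))^-1 *
      (N M * (1 - X M k.+1%:Z * X M (- k.+1%:Z))).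
      have -> : X M k.+1%:Z * X M (- k.+1%:Z) = nome (z / N M) ^+ 2.
        rewrite -nomeD expr2 -nomeD; congr nome.
        by rewrite mulrNz; ring.
      by ring.
    rewrite /g; have := N_neq0 M; move: (N M) (X M _) (X M _) X1 X2 => n x y ? ? ?.
    by field; rewrite -?andbA; apply/and3P.
  rewrite !cabsM cabsV cabsV.
  have b1 : cabs (N M) * cabs (1 - nome (z / N M)) <= C.
    by rewrite cabs_nat mulrC -ler_pdivlMr//; exact: hC.
  have b2 : cabs (1 + nome (z / N M)) <= 2.
    apply: le_trans (cabsD _ _ _) _; rewrite (cabs_nat _ 1) -[leRHS]/(1 + 1).
    rewrite lerD2l ltW// cabs_nome_lt1//.
    have -> : z / N M = (complex.Re z / M.*2.+1%:R) +i* (complex.Im z / M.*2.+1%:R).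
      case: (z) => a b.
      by rewrite /N -(rmorph_nat (real_complex R)) -fmorphV/=; simpc.
    by rewrite /= divr_gt0.
  have k1 : 0 < k.+1%:R :> R by [].
  apply: (@le_trans _ _ ((d * k.+1%:R)^-1 * (d * k.+1%:R)^-1 * C * 2)).
    have i0 (t : R[i]) : 0 <= (cabs t)^-1 by rewrite invr_ge0 cabs_ge0.
    have k2 : (d * (`|k.+1%:Z|.+1)%:R)^-1 <= (d * k.+1%:R)^-1.
      by rewrite lef_pV2 ?posrE ?mulr_gt0// ler_pM2l// ler_nat.
    rewrite !ler_pM ?mulr_ge0 ?cabs_ge0 ?i0//.
    - exact: le_trans h1 k2.
    - exact: le_trans h2 k2.
  by rewrite le_eqVlt; apply/orP; left; apply/eqP; field; rewrite !gt_eqF.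
- move=> k; rewrite -[X in ccvg _ X]subr0 -[X in ccvg _ (_ - X)](mul0r 2^-1).
  apply: ccvgD; last by apply: ccvgN; apply: ccvgM => //; exact: ccvg_cst.
  by apply: ccvgV => //; rewrite oppr_eq0 mulf_neq0.
- apply/ccvgE; apply: cvg_near_cst; near=> M => /=.
  rewrite (_ : g M = fun k => (N M)^-1 * ((1 - X M k)^-1 + (- 2^-1))); last first.
    by apply/funext => k; rewrite /g invfM; ring.
  rewrite csymZ /csymmetric_partial_sum big_split /= sumr_const card_ord.
  have := csym_inv_1B_nome _ z M z_gt0.
  rewrite /csymmetric_partial_sum -/(N M) => ->.
  rewrite -[_ *+ _]mulr_natl; have := N_neq0 M; rewrite -/(N M).
  by move: (N M) (nome _) w1 => n x ? ?; field; apply/andP.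
Unshelve. all: by end_near. Qed.

(** This is [pi ^+ 2 / sin (pi * z) ^+ 2], and the derivative of [eisenstein1] up
    to sign. Each term is dominated on its own. *)
Lemma eisenstein2 :
  ccvg (csymmetric_partial_sum (fun k => (z + k%:~R) ^- 2))
    (((2 * pi)%:C * 'i%C) ^+ 2 * (nome z / (1 - nome z) ^+ 2)).
Proof.
have [d d0 hd] := lower_bound.
pose g M (k : int) := X M k * ((N M * (1 - X M k))^-1) ^+ 2.
have := @symmetric_tannery R g
  (fun k => 1 * ((- (kappa * (z + k%:~R)))^-1 * (- (kappa * (z + k%:~R)))^-1))
  (fun k => (2 / d ^+ 2) * k.+1%:R ^- 2)
  (nome z / (1 - nome z) ^+ 2) (cvg_dominant _).
have -> : csymmetric_partial_sum (fun k => (z + k%:~R) ^- 2) =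
   fun K => kappa ^+ 2 *
     csymmetric_partial_sum (fun k =>
       1 * ((- (kappa * (z + k%:~R)))^-1 * (- (kappa * (z + k%:~R)))^-1)) K.
  apply/funext => K; rewrite -csymZ; congr csymmetric_partial_sum.
  apply/funext => k; have := shift_neq0 k; move: (z + _) kappa_neq0 => s ? ?.
  by field; apply/andP.
move=> T; apply: ccvgM; first exact: ccvg_cst.
apply: T.
- move=> M k kM.
  have k1 : 0 < k.+1%:R :> R by [].
  have bd s : s = k.+1%:Z \/ s = - k.+1%:Z ->
      cabs (g M s) <= d ^- 2 * k.+1%:R ^- 2.
    move=> sE; have sk : (`|s| = k.+1)%N by case: sE => ->.
    have [|h _] := hd M s; first by rewrite sk.
    rewrite /g cabsM cabsX cabsV -[leRHS]mul1r.
    rewrite ler_pM ?exprn_ge0 ?invr_ge0 ?cabs_ge0//.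
      rewrite ltW// cabs_nome_lt1//.
      have -> : (z + s%:~R) / N M = ((complex.Re z + s%:~R) / M.*2.+1%:R) +i*
          (complex.Im z / M.*2.+1%:R).
        case: (z) => a b.
        rewrite /N -(rmorph_nat (real_complex R)) -fmorphV/=.
        by rewrite -(rmorph_int (real_complex R)); simpc.
      by rewrite /= divr_gt0.
    rewrite -invfM -exprMn -[leRHS]exprVn lerXn2r ?nnegrE//;
      rewrite ?invr_ge0 ?cabs_ge0 ?mulr_ge0 ?(ltW d0)//.
    apply: le_trans h _; rewrite lef_pV2 ?posrE ?mulr_gt0// ler_pM2l// ler_nat.
    by rewrite sk.
  apply: le_trans (cabsD _ _ _) _.
  rewrite -mulrA mulr_natl mulr2n lerD//; apply: bd; by [left|right].
- move=> k; apply: ccvgM => //; rewrite /=.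
  by apply: ccvgM; apply: ccvgV => //; rewrite oppr_eq0 mulf_neq0.
- apply/ccvgE; apply: cvg_near_cst; near=> M => /=.
  rewrite (_ : g M = fun k => (N M)^-2 * (X M k / (1 - X M k) ^+ 2)); last first.
    by apply/funext => k; rewrite /g exprVn exprMn invfM; ring.
  by rewrite csymZ csym_sqr_inv_1B_nome// mulKf// expf_neq0.
Unshelve. all: by end_near. Qed.

End eisenstein_series.

(** * Lambert series *)

Section lattice_sums.
Variable R : realType.
Implicit Types (w q z : R[i]) (x y b r : R).

Lemma ccvg_dominated (u : nat -> R[i]) (h : nat -> R) :
  cvgn (series h) -> (forall n, cabs (u n) <= h n) ->
  exists l, ccvg (series u) l.
Proof.
move=> ch uh.
have cu (v : nat -> R) : (forall n, `|v n| <= h n) -> cvgn (series v).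
  move=> vh; apply: normed_cvg; apply: series_le_cvg ch => //= n.
  by apply: le_trans (vh n).
exists (limn (series (fun n => complex.Re (u n))) +i*
        limn (series (fun n => complex.Im (u n)))).
by apply/ccvg_seriesP; split; apply: cu => n;
  [apply: le_trans (le_Re_cabs _ _) _|apply: le_trans (le_Im_cabs _ _) _].
Qed.

(** The closed form of [sum_(j >= 1) (1 + 2 pi b j) w ^+ j]. *)
Definition lambert w b : R[i] :=
  w / (1 - w) + (2 * pi * b)%:C * (w / (1 - w) ^+ 2).

Lemma ccvg_lambert w b : cabs w < 1 ->
  ccvg (series (fun j => (1 + 2 * pi * b * j.+1%:R)%:C * w ^+ j.+1))
    (lambert w b).
Proof.
move=> w1; rewrite (_ : (fun j => _) = fun j => w ^+ j.+1 +
    (2 * pi * b)%:C * (j.+1%:R * w ^+ j.+1)).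
  apply: ccvg_seriesD; first exact: ccvg_geometric.
  by apply: ccvg_seriesM; exact: ccvg_arith_geometric.
apply/funext => j.
by rewrite rmorphD !rmorphM rmorph1 !rmorph_nat/=; ring.
Qed.

(** For [s = u + i y], [i / s - y / s ^+ 2] has real part
    [2 y ^+ 3 / (u ^+ 2 + y ^+ 2) ^+ 2], the term of the Epstein zeta function,
    and imaginary part [u (u ^+ 2 + 3 y ^+ 2) / (u ^+ 2 + y ^+ 2) ^+ 2], which
    is [n ^+ 3 * lattice_term] for [y] replaced by [n y]. Both sums are therefore read off the same
    combination of [eisenstein1] and [eisenstein2]. *)
Lemma symmetric_lambert x y : 0 < y ->
  symmetric_partial_sum (fun k => let u := k%:~R + x in
    u * (u ^+ 2 + 3 * y ^+ 2) / (u ^+ 2 + y ^+ 2) ^+ 2) @ \oo -->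
    2 * pi * complex.Im (lambert (nome (x +i* y)) y) /\
  symmetric_partial_sum (fun k => ((k%:~R + x) ^+ 2 + y ^+ 2) ^- 2) @ \oo -->
    (pi + 2 * pi * complex.Re (lambert (nome (x +i* y)) y)) / (2 * y ^+ 3).
Proof.
move=> y0.
have e1 := eisenstein1 R (x +i* y) y0.
have e2 := eisenstein2 R (x +i* y) y0.
set w := nome _ in e1 e2 *.
pose Q k := let u := k%:~R + x in
    u * (u ^+ 2 + 3 * y ^+ 2) / (u ^+ 2 + y ^+ 2) ^+ 2.
pose P (k : int) := ((k%:~R + x) ^+ 2 + y ^+ 2) ^- 2.
have termE k : (2 * y ^+ 3 * P k) +i* Q k =
   'i%C * ((x +i* y) + k%:~R)^-1 + - y%:C * ((x +i* y) + k%:~R) ^- 2.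
  have -> : (x +i* y) + k%:~R = (k%:~R + x) +i* y.
    by rewrite -(rmorph_int (real_complex R)); simpc; rewrite addrC.
  rewrite /P /Q; move: (k%:~R + x) => u.
  have uy : u ^+ 2 + y ^+ 2 != 0.
    by rewrite gt_eqF// ltr_wpDl ?sqr_ge0// exprn_gt0.
  have iE : (u +i* y)^-1 = (u / (u ^+ 2 + y ^+ 2)) -i* (y / (u ^+ 2 + y ^+ 2)) by [].
  rewrite [(u +i* y) ^+ 2]expr2 iE; simpc.
  have -> : (u * u - y * y) ^+ 2 + (u * y + y * u) ^+ 2 =
    (u ^+ 2 + y ^+ 2) ^+ 2 by ring.
  by congr Complex; field.
have S K : (2 * y ^+ 3 * symmetric_partial_sum P K) +i* symmetric_partial_sum Q K =
  'i%C * csymmetric_partial_sum (fun k => ((x +i* y) + k%:~R)^-1) K +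
   - y%:C * csymmetric_partial_sum (fun k => ((x +i* y) + k%:~R) ^- 2) K.
  rewrite /csymmetric_partial_sum /symmetric_partial_sum !mulr_sumr -big_split /=.
  rewrite -(eq_bigr _ (fun i _ => termE _)).
  elim: (K.*2.+1) => [|n IH]; first by rewrite !big_ord0.
  by rewrite !big_ord_recr /= -IH; simpc.
have C := ccvgD _ _ _ _ _
  (ccvgM _ _ _ _ _ (ccvg_cst _ 'i%C) e1)
  (ccvgM _ _ _ _ _ (ccvg_cst _ (- y%:C)) e2).
have E : 'i%C * (- ((2 * pi)%:C * 'i%C) * (1 / 2 + w / (1 - w))) +
   - y%:C * (((2 * pi)%:C * 'i%C) ^+ 2 * (w / (1 - w) ^+ 2)) =
   pi%:C + (2 * pi)%:C * lambert w y.
  rewrite /lambert; set A := w / _; set B := w / _.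
  have i2 : 'i%C * 'i%C = -1 :> R[i] by rewrite -expr2 sqr_i.
  rewrite !rmorphM !rmorph_nat /=; move: (pi%:C) (y%:C) ('i%C) i2 => p t i i2.
  apply: (@eq_trans _ _ (- (i * i) * (p + 2 * p * (A + 2 * p * t * B)))).
    by field.
  by rewrite i2 opprK mul1r.
have {}C : ccvg (fun K => (2 * y ^+ 3 * symmetric_partial_sum P K) +i*
    symmetric_partial_sum Q K) (pi%:C + (2 * pi)%:C * lambert w y).
  by rewrite -E; under eq_fun do rewrite S.
have [ReE ImE] : complex.Re (pi%:C + (2 * pi)%:C * lambert w y) =
     pi + 2 * pi * complex.Re (lambert w y) /\
   complex.Im (pi%:C + (2 * pi)%:C * lambert w y) =
     2 * pi * complex.Im (lambert w y).
  by case: (lambert w y) => a b; split; simpc.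
have [C1 C2] := C; rewrite ReE in C1; rewrite ImE in C2; split; first exact: C2.

have y3 : 2 * y ^+ 3 != 0 by rewrite mulf_neq0// expf_neq0// gt_eqF.
rewrite -[symmetric_partial_sum _]/(symmetric_partial_sum P).
rewrite (_ : symmetric_partial_sum P = fun K =>
  2 * y ^+ 3 * symmetric_partial_sum P K * (2 * y ^+ 3)^-1).
  exact: cvgMr_tmp C1.
by apply/funext => K; rewrite mulrAC divff// mul1r.
Qed.

(** The double series of terms
    [(1 / n ^+ 3 + 2 pi y j / n ^+ 2) * q ^+ (n * j)] is dominated by a product
    of two convergent series. Summed over [n] first it gives the polylogarithms
    in [F], because [ln |q ^+ j| = - 2 pi y j]; summed over [j] first it gives
    the Lambert series. *)
Lemma ccvg_lambert_term x y : 0 < y ->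
  let q := nome (x +i* y) in
  let A n := (n.+1%:R ^- 3)%:C * lambert (q ^+ n.+1) (n.+1%:R * y) in
  (exists C, forall n, `|complex.Im (A n)| <= C * n.+1%:R ^- 2) /\
  exists S, ccvg (series A) S /\
    F q = (8 * pi ^+ 2 * y ^+ 3 / 3 + 120 / pi * zeta R 3)%:C +
          (240 / pi)%:C * S.
Proof.
move=> y0 q A.
have q1 : cabs q < 1 by exact: cabs_nome_lt1.
have lnq j : ln (cabs (q ^+ j.+1)) = - (2 * pi * y) * j.+1%:R.
  by rewrite cabsX cabs_nome -expRM_natl expRK mulrC.
set r := cabs q in q1 lnq.
have r0 : 0 <= r by exact: cabs_ge0.
pose f (n j : nat) : R[i] :=
  (n.+1%:R ^- 3 + 2 * pi * y * j.+1%:R * n.+1%:R ^- 2)%:C *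
  q ^+ (n.+1 * j.+1).
pose g n : R := n.+1%:R ^- 2.
pose h (j : nat) : R := r ^+ j.+1 + 2 * pi * y * (j.+1%:R * r ^+ j.+1).
have g0 n : 0 <= g n by rewrite invr_ge0 exprn_ge0.
have piy : 0 <= 2 * pi * y :> R by rewrite !mulr_ge0 ?pi_ge0 ?ltW.
have h0 j : 0 <= h j.
  apply: addr_ge0; first exact: exprn_ge0.
  by apply: mulr_ge0 => //; apply: mulr_ge0 => //; exact: exprn_ge0.
have coef0 (n j : nat) :
    0 <= n.+1%:R ^- 3 + 2 * pi * y * j.+1%:R * n.+1%:R ^- 2 :> R.
  by apply: addr_ge0; rewrite ?invr_ge0 ?exprn_ge0//; apply: mulr_ge0;
    [exact: mulr_ge0|rewrite invr_ge0 exprn_ge0].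
have ch : cvgn (series h).
  have r01 : 0 <= r < 1 by rewrite r0.
  apply: (cvgP _ (cvg_seriesD _ _ _ _ _ _ (cvg_series_geometric _ _ r01)
    (cvg_seriesM _ _ (2 * pi * y) _ (cvg_series_arith_geometric _ _ r01)))).
have fgh n j : cabs (f n j) <= g n * h j.
  have n1 : 1 <= n.+1%:R :> R by rewrite ler1n.
  rewrite cabsM cabs_real// cabsX -/r.
  apply: (@le_trans _ _ (g n * (1 + 2 * pi * y * j.+1%:R) * r ^+ j.+1)); last first.
    by rewrite le_eqVlt; apply/orP; left; apply/eqP; rewrite /h; ring.
  rewrite ler_pM ?exprn_ge0//.
  - have -> : g n * (1 + 2 * pi * y * j.+1%:R) =
        n.+1%:R ^- 2 + 2 * pi * y * j.+1%:R * n.+1%:R ^- 2 by rewrite /g; ring.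
    rewrite lerD2r.
    by rewrite lef_pV2 ?posrE ?exprn_gt0//; exact: ler_weXn2l.
  - by apply: ler_wiXn2l => //; [exact: ltW|rewrite leq_pmull].
have row n : ccvg (series (f n)) (A n).
  rewrite (_ : f n = fun j => (n.+1%:R ^- 3)%:C *
    ((1 + 2 * pi * (n.+1%:R * y) * j.+1%:R)%:C * (q ^+ n.+1) ^+ j.+1)).
    apply: ccvg_seriesM; apply: ccvg_lambert.
    by rewrite cabsX -/r exprn_ilt1.
  apply/funext => j; rewrite /f exprM mulrA -rmorphM; congr (_%:C * _).
  by field.
have LiP k w : (1 < k)%N -> cabs w <= r ->
    ccvg (series (fun m => w ^+ m.+1 / m.+1%:R ^+ k)) (Li k w).
  move=> k1 wr.
  have [|l cl] := @ccvg_dominated (fun m => w ^+ m.+1 / m.+1%:R ^+ k) g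
    (cvg_series_invn2 R).
    move=> m; rewrite cabsM cabsX cabsV cabsX cabs_nat -[leRHS]mul1r.
    rewrite ler_pM ?exprn_ge0 ?invr_ge0 ?exprn_ge0 ?cabs_ge0//.
      by rewrite exprn_ile1 ?cabs_ge0// (le_trans wr)// ltW.
    rewrite lef_pV2 ?posrE ?exprn_gt0//; apply: ler_weXn2l => //.
    by rewrite ler1n.
  by rewrite /Li (cseriesE _ _ _ cl).
have col j : ccvg (series (f ^~ j)) (Li 3 (q ^+ j.+1)
                      - (ln (cabs (q ^+ j.+1)))%:C * Li 2 (q ^+ j.+1)).
  have qj : cabs (q ^+ j.+1) <= r.
    by rewrite cabsX -/r -[leRHS]expr1; apply: ler_wiXn2l => //; exact: ltW.
  rewrite lnq rmorphM rmorphN !mulNr opprK.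
  rewrite (_ : f^~ j = fun n => (q ^+ j.+1) ^+ n.+1 / n.+1%:R ^+ 3 +
     (2 * pi * y)%:C * (j.+1%:R)%:C * ((q ^+ j.+1) ^+ n.+1 / n.+1%:R ^+ 2)).
    apply: ccvg_seriesD; first exact: LiP.
    by apply: ccvg_seriesM; exact: LiP.
  apply/funext => n; rewrite /f mulnC exprM rmorphD !(rmorphM (real_complex R)).
  by rewrite !(fmorphV (real_complex R)) !rmorphXn !rmorph_nat/=; ring.
split.
  exists (limn (series h)) => n; have /ccvg_seriesP[_ rowIm] := row n.
  have fgh' j : `|complex.Im (f n j)| <= g n * h j.
    by apply: le_trans (fgh n j); exact: le_Im_cabs.
  have := series_tail_le _ _ _ _ _ 0 rowIm (cvg_seriesM _ _ (g n) _ ch) fgh'.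
  by rewrite /series /= !big_geq// !subr0 mulrC.
have [S [S1 S2]] := cseries_exchange _ f g h _ _ (cvg_series_invn2 R) ch g0 h0
  fgh row col.
exists S; split => //.
rewrite /F (cseriesE _ _ _ S2); congr (_ + _).
rewrite -rmorphD; congr (_%:C); congr (_ + _).
rewrite cabs_nome expRK /=; move: (pi_gt0 R); move: (pi : R) => p p0.
by field; rewrite gt_eqF.
Qed.

End lattice_sums.

Arguments lambert {R}.

(** * Unordered sums over the integers *)

Section sums_over_int.
Variable R : realType.
Implicit Types (f g : int -> R) (l s : R).

Lemma nneseries_EFin (u : nat -> R) s : (forall n, 0 <= u n) ->
  series u @ \oo --> s -> (\sum_(0 <= n <oo) (u n)%:E = s%:E)%E.
Proof.
move=> u0 us; apply: cvg_lim => //.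
rewrite (_ : (fun n => _) = EFin \o series u).
  by apply: cvg_EFin; [exact: nearW|exact: us].
by apply/funext => n; rewrite /= /series /= sumEFin.
Qed.

Lemma symmetric_partial_sumE f K : symmetric_partial_sum f K =
  f 0 + series (fun k => f k.+1%:Z + f (- k.+1%:Z)) K.
Proof. exact: sum_symmetric. Qed.

(** The integers split into the naturals and the negatives; the partial sums of
    the two halves together miss only the term [g K] of the symmetric sum, which
    tends to zero. *)
Lemma esum_int g l : (forall k, 0 <= g k) ->
  symmetric_partial_sum g @ \oo --> l ->
  \esum_(k in [set: int]) (g k)%:E = l%:E.
Proof.
move=> g0 gl.
rewrite (esumID (range Posz))//; last by move=> k _; rewrite lee_fin.
rewrite !setTI (_ : ~` range Posz = range Negz); last first.
  apply/seteqP; split=> [[n|n] //= h|_ [n _ <-] [m _]//].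
    by exfalso; apply: h; exists n.
  by exists n.
rewrite !esum_image; try by move=> i j _ _ [].
rewrite -!nneseries_esumT; try by move=> n; rewrite lee_fin.
rewrite -nneseriesD; try by move=> n _; rewrite lee_fin.
under eq_eseriesr do rewrite -EFinD.
apply: nneseries_EFin; first by move=> n; rewrite addr_ge0.
have gp : series (fun k => g k.+1%:Z + g (- k.+1%:Z)) @ \oo --> l - g 0.
  apply: eq_cvgn (cvgB gl (cvg_cst (g 0))) => K.
  by rewrite fctE symmetric_partial_sumE addrAC subrr add0r.
have gK : (fun K : nat => g K) @ \oo --> (0 : R).
  rewrite -cvg_shiftS; have := cvg_series_cvg_0 (cvgP _ gp).
  move=> c0; apply: (squeeze_cvgr _ (cvg_cst 0) c0); apply: nearW => n /=.
  by rewrite g0 lerDl g0.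
rewrite -[l]subr0; apply: eq_cvgn (cvgB gl gK) => K.
rewrite fctE symmetric_partial_sumE /series /=.
suff -> : \sum_(0 <= k < K) (g k + g (Negz k)) =
    g 0 + \sum_(0 <= k < K) (g k.+1%:Z + g (- k.+1%:Z)) - g K by [].
elim: K => [|K IH]; first by rewrite !big_nil addr0 subrr.
by rewrite !big_nat_recr//= IH NegzE; ring.
Qed.

Lemma symmetric_even f s : (forall k, f (- k) = f k) ->
  series (fun n => f n.+1%:Z) @ \oo --> s ->
  symmetric_partial_sum f @ \oo --> f 0 + 2 * s.
Proof.
move=> fN fs.
apply: eq_cvgn (cvgD (cvg_cst (f 0)) (cvg_seriesM _ _ 2 _ fs)) => K.
rewrite fctE symmetric_partial_sumE; congr (_ + _); apply: eq_bigr => k _.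
by rewrite fN mulr_natl mulr2n.
Qed.

Let nonzero : set int := [set n : int | n <> 0].

Lemma esum_nonzero_even (h : int -> R) s : (forall k, 0 <= h k) ->
  (forall k, h (- k) = h k) -> series (fun n => h n.+1%:Z) @ \oo --> s ->
  \esum_(k in nonzero) (h k)%:E = (2 * s)%:E.
Proof.
move=> h0 hN hs; pose g k := if k == 0 then 0 else h k.
have -> : \esum_(k in nonzero) (h k)%:E = \esum_(k in [set: int]) (g k)%:E.
  rewrite esum_mkcond; apply: eq_esum => k _; rewrite /g.
  case: eqVneq => [->|/eqP k0]; first by rewrite ifF// memNset//= => /(_ erefl).
  by rewrite ifT// inE.
apply: esum_int => [k|]; first by rewrite /g; case: ifP.
have g00 : g 0 = 0 by rewrite /g eqxx.
have := symmetric_even g s; rewrite g00 add0r; apply.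
  by move=> k; rewrite /g oppr_eq0 hN.
by rewrite (_ : (fun n => g _) = fun n : nat => h n.+1%:Z).
Qed.

(** The positive and the negative parts of [f] are even and nonnegative, so
    [esum_nonzero_even] evaluates both unordered sums. *)
Lemma unordered_sum_even f s : (forall k, f (- k) = f k) ->
  cvgn (series (fun n => `|f n.+1%:Z|)) ->
  series (fun n => f n.+1%:Z) @ \oo --> s ->
  summable nonzero (EFin \o f) /\ unordered_sum nonzero f = 2 * s.
Proof.
move=> fN cf fs; split.
  rewrite /summable.
  rewrite (_ : \esum_(x in nonzero) _ = \esum_(x in nonzero) `|f x|%:E)//.
  by rewrite (esum_nonzero_even _ _ _ _ cf) ?ltry// => k; rewrite fN.
have cp : cvgn (series (fun n => Num.max (f n.+1%:Z) 0)).
  apply: series_le_cvg cf => //= n; first by rewrite le_max lexx orbT.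
  by rewrite ge_max normr_ge0 ler_norm.
have cm : cvgn (series (fun n => Num.max (- f n.+1%:Z) 0)).
  apply: series_le_cvg cf => //= n; first by rewrite le_max lexx orbT.
  by rewrite ge_max normr_ge0 -normrN ler_norm.
rewrite /unordered_sum.
rewrite (_ : \esum_(i in nonzero) ((EFin \o f)^\+)%E i =
  \esum_(i in nonzero) (Num.max (f i) 0)%:E); last first.
  by apply: eq_esum => i _; rewrite funeposE /= EFin_max.
rewrite (_ : \esum_(i in nonzero) ((EFin \o f)^\-)%E i =
  \esum_(i in nonzero) (Num.max (- f i) 0)%:E); last first.
  by apply: eq_esum => i _; rewrite funenegE /= EFin_max.
have max0 (t : R) : 0 <= Num.max t 0 by rewrite le_max lexx orbT.
rewrite (esum_nonzero_even _ _ (fun k => max0 _) _ cp); last first.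
  by move=> k; rewrite fN.
rewrite (esum_nonzero_even _ _ (fun k => max0 _) _ cm); last first.
  by move=> k; rewrite fN.
rewrite -EFinB /= -mulrBr; congr (_ * _).
have := cvg_series_sub _ _ _ _ _ _ cp cm.
rewrite (_ : (fun n => _ - _) = fun n => f n.+1%:Z).
  by move=> /cvg_unique; apply.
apply/funext => n; rewrite /Num.max; case: ltP => ?; case: ltP => ?; lra.
Qed.

End sums_over_int.

(** * The lattice sums and the inversion tau -> -1/tau *)

Section modular_relation.
Variable R : realType.
Implicit Types (x y : R).

Lemma lattice_termN x y n k : lattice_term x y (- n) (- k) = lattice_term x y n k.
Proof.
rewrite /lattice_term !rmorphN /=.
move: (n%:~R) (k%:~R) => a b.
have -> : - b + - a * x = - (b + a * x) by ring.
move: (b + a * x) => u.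
rewrite !sqrrN (_ : (- a) ^+ 3 = - a ^+ 3); last by ring.
by rewrite !mulNr invrN mulrN opprK.
Qed.

Lemma symmetric_lattice_termN x y n :
  symmetric_partial_sum (lattice_term x y (- n)) =
  symmetric_partial_sum (lattice_term x y n).
Proof.
apply/funext => K; rewrite !symmetric_partial_sumE; congr (_ + _).
  by rewrite -[0 in LHS]oppr0 lattice_termN.
apply: eq_bigr => k _; rewrite addrC; congr (_ + _).
  by rewrite lattice_termN.
by rewrite -[k.+1%:Z in LHS]opprK lattice_termN.
Qed.

(** Its real and imaginary parts are, up to elementary terms, the sums over [k] in
    the row [n.+1] of the Epstein zeta function and of the conditionally
    convergent double sum. *)
Definition lambert_term x y (n : nat) : R[i] :=
  (n.+1%:R ^- 3)%:C * lambert (nome (x +i* y) ^+ n.+1) (n.+1%:R * y).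

Lemma nome_scale x y n : nome (x +i* y) ^+ n = nome ((n%:R * x) +i* (n%:R * y)).
Proof.
rewrite -nomeMn; congr nome.
by rewrite -(rmorph_nat (real_complex R)); simpc.
Qed.

Lemma cvg_symmetric_lattice x y n : 0 < y ->
  symmetric_partial_sum (lattice_term x y n.+1%:Z) @ \oo -->
    2 * pi * complex.Im (lambert_term x y n).
Proof.
move=> y0; have ny0 : 0 < n.+1%:R * y by rewrite mulr_gt0.
have [H _] := symmetric_lambert _ (n.+1%:R * x) _ ny0.
rewrite /lambert_term nome_scale (_ : complex.Im (_ * _) =
  n.+1%:R ^- 3 * complex.Im (lambert (nome ((n.+1%:R * x) +i* (n.+1%:R * y)))
    (n.+1%:R * y))); last first.
  by case: (lambert _ _) => a b; simpc.
rewrite mulrCA; apply: eq_cvgn (cvgMl_tmp H) => K.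
rewrite /symmetric_partial_sum mulr_sumr; apply: eq_bigr => i _.
by rewrite /lattice_term -pmulrn invfM exprMn; ring.
Qed.

Lemma cvg_symmetric_epstein x y n : 0 < y ->
  symmetric_partial_sum (fun k =>
    ((k%:~R + n.+1%:R * x) ^+ 2 + (n.+1%:R * y) ^+ 2) ^- 2) @ \oo -->
    (pi * n.+1%:R ^- 3 + 2 * pi * complex.Re (lambert_term x y n)) / (2 * y ^+ 3).
Proof.
move=> y0; have ny0 : 0 < n.+1%:R * y by rewrite mulr_gt0.
have [_ H] := symmetric_lambert _ (n.+1%:R * x) _ ny0.
rewrite /lambert_term nome_scale (_ : complex.Re (_ * _) =
  n.+1%:R ^- 3 * complex.Re (lambert (nome ((n.+1%:R * x) +i* (n.+1%:R * y)))
    (n.+1%:R * y))); last first.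
  by case: (lambert _ _) => a b; simpc.
move: H; rewrite (_ : _ / _ = (pi * n.+1%:R ^- 3 + 2 * pi *
   (n.+1%:R ^- 3 * complex.Re (lambert (nome ((n.+1%:R * x) +i* (n.+1%:R * y)))
    (n.+1%:R * y)))) / (2 * y ^+ 3))//.
move: (complex.Re _) (pi : R) => t p.
by field; rewrite nat1r pnatr_eq0 gt_eqF.
Qed.

(** Grouping [k] with [-k] makes the double sum absolutely convergent. *)
Definition lattice_pair x y (n k : nat) : R :=
  lattice_term x y n.+1%:Z k.+1%:Z + lattice_term x y n.+1%:Z (- k.+1%:Z).

Lemma lattice_term0 x y n : 0 < y -> lattice_term x y n.+1%:Z 0 =
  x * (x ^+ 2 + 3 * y ^+ 2) / (x ^+ 2 + y ^+ 2) ^+ 2 * n.+1%:R ^- 4.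
Proof.
move=> y0; have N0 : x ^+ 2 + y ^+ 2 != 0.
  by rewrite gt_eqF// ltr_wpDl ?sqr_ge0// exprn_gt0.
rewrite /lattice_term -pmulrn add0r.
have : n.+1%:R != 0 :> R by rewrite pnatr_eq0.
move: (n.+1%:R) => a a0.
have -> : (a * x) ^+ 2 + a ^+ 2 * y ^+ 2 = a ^+ 2 * (x ^+ 2 + y ^+ 2) by ring.
by field; apply/andP.
Qed.

Lemma cvg_lattice_pair x y n : 0 < y ->
  series (lattice_pair x y n) @ \oo -->
    2 * pi * complex.Im (lambert_term x y n) - lattice_term x y n.+1%:Z 0.
Proof.
move=> y0; apply: eq_cvgn (cvgB (cvg_symmetric_lattice x y n y0)
  (cvg_cst (lattice_term x y n.+1%:Z 0))) => K.
by rewrite fctE symmetric_partial_sumE addrAC subrr add0r.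
Qed.

(** The map [(n, k) -> (k, -n)] and [tau -> -1 / tau] preserve the quadratic form
    [|k + n tau| ^+ 2] up to the factor [N = |tau| ^+ 2]. The two terms have the
    same double and simple poles at the zeros of that form, so their difference
    has poles only at [n = 0] and [k = 0]; being homogeneous of degree -4 it is a
    combination of [1 / (n ^+ 3 k)], [1 / (n ^+ 2 k ^+ 2)] and
    [1 / (n k ^+ 3)]. *)
Lemma lattice_term_modular x y (n k : int) : 0 < y -> n != 0 -> k != 0 ->
  let N := x ^+ 2 + y ^+ 2 in
  lattice_term x y n k = N * lattice_term (- x / N) (y / N) k (- n) +
    ((n%:~R ^+ 3 * k%:~R)^-1 - x * (n%:~R ^- 2 * k%:~R ^- 2) +
     N * (n%:~R * k%:~R ^+ 3)^-1).
Proof.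
move=> y0 n0 k0 N; have N0 : x ^+ 2 + y ^+ 2 != 0.
  by rewrite gt_eqF// ltr_wpDl ?sqr_ge0// exprn_gt0.
rewrite /lattice_term rmorphN /=.
have : n%:~R != 0 :> R by rewrite intr_eq0.
have : k%:~R != 0 :> R by rewrite intr_eq0.
move: (n%:~R) (k%:~R) => a b b0 a0.
have D0 : (b + a * x) ^+ 2 + a ^+ 2 * y ^+ 2 != 0.
  rewrite gt_eqF// ltr_wpDl ?sqr_ge0//.
  by apply: mulr_gt0; [rewrite exprn_even_gt0|exact: exprn_gt0].
have D1 : (- a * (x ^+ 2 + y ^+ 2) + b * - x) ^+ 2 + (b * y) ^+ 2 != 0.
  have -> : (- a * (x ^+ 2 + y ^+ 2) + b * - x) ^+ 2 + (b * y) ^+ 2 =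
    (x ^+ 2 + y ^+ 2) * ((b + a * x) ^+ 2 + a ^+ 2 * y ^+ 2) by ring.
  exact: mulf_neq0.
have D2 : (b + a * x) ^+ 2 + (a * y) ^+ 2 != 0 by rewrite exprMn.
by rewrite /N; field; apply/and5P; split.
Qed.

(** Only the monomial which is even in [k] survives the pairing. *)
Lemma lattice_pair_modular x y n k : 0 < y ->
  let N := x ^+ 2 + y ^+ 2 in
  lattice_pair x y n k = N * lattice_pair (- x / N) (y / N) k n -
    2 * x * (n.+1%:R ^- 2 * k.+1%:R ^- 2).
Proof.
move=> y0 N; rewrite /lattice_pair.
rewrite (lattice_term_modular _ _ n.+1%:Z k.+1%:Z)//.
rewrite (lattice_term_modular _ _ n.+1%:Z (- k.+1%:Z))// -/N lattice_termN.
rewrite !rmorphN /= -!pmulrn.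
have an0 (m : nat) : m.+1%:R != 0 :> R by rewrite pnatr_eq0.
move: (lattice_term _ _ _ _) (lattice_term _ _ _ _) => t t'.
by move: (n.+1%:R) (k.+1%:R) (an0 n) (an0 k) => a b a0 b0; field; apply/andP.
Qed.

(** Write [D+] and [D-] for the values of the quadratic form at [(n, k)] and
    [(n, -k)], which are at least a constant times [E = n ^+ 2 + k ^+ 2]. The
    terms of the pair that are odd in [k] nearly cancel, and what remains is
    [x / n ^+ 2] times a sum of products of [1 / D+] and [1 / D-] of homogeneous
    degree -2, hence is [O(1 / (n ^+ 2 E))]. *)
Lemma lattice_pair_bound x y : 0 < y -> exists2 C, 0 <= C &
  forall n k, `|lattice_pair x y n k| <= n.+1%:R ^- 2 * (C * k.+1%:R ^- 2).
Proof.
move=> y0; set N := x ^+ 2 + y ^+ 2.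
have N0 : 0 < N by rewrite ltr_wpDl ?sqr_ge0// exprn_gt0.
set L := (1 + N) / y ^+ 2.
have N1 : 0 < 1 + N by rewrite ltr_wpDl.
have L0 : 0 < L by apply: divr_gt0 => //; exact: exprn_gt0.
have y20 : 0 <= y ^+ 2 by exact: sqr_ge0.
pose B := 4 * (L * L) + (L + L) +
  2 * (y ^+ 2 * (8 * ((1 + N) * (L * L * (L * L))) + (L * L + L * L))).
have LL0 : 0 <= L * L by rewrite mulr_ge0 ?ltW.
have B0 : 0 <= B.
  have L0' := ltW L0; have N1' := ltW N1.
  by do ![apply: addr_ge0 => //|apply: mulr_ge0 => //].
exists (`|x| * B); first by rewrite mulr_ge0.
move=> n k; rewrite /lattice_pair /lattice_term rmorphN /= -!pmulrn.
have a0 : 0 < n.+1%:R :> R by [].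
have b0 : 0 < k.+1%:R :> R by [].
move: (n.+1%:R) (k.+1%:R) a0 b0 => a b a0 b0.
pose E := a ^+ 2 + b ^+ 2.
have a20 : 0 < a ^+ 2 by rewrite exprn_gt0.
have b20 : 0 < b ^+ 2 by rewrite exprn_gt0.
have E0 : 0 < E by rewrite addr_gt0.
pose A := b ^+ 2 + a ^+ 2 * N.
(* The form has determinant y ^+ 2 and trace 1 + N, so that its eigenvalues
   are at least 1 / L. *)
have form s : (s == 1) || (s == -1) ->
    0 < A + s * (2 * a * b * x) /\ (A + s * (2 * a * b * x))^-1 <= L / E.
  move=> s1; have s2 : s ^+ 2 = 1.
    by case/orP: s1 => /eqP ->; rewrite ?sqrrN expr1n.
  have h : E * y ^+ 2 <= (1 + N) * (A + s * (2 * a * b * x)).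
    rewrite -subr_ge0 (_ : _ - _ = (b * x + s * (a * N)) ^+ 2 +
      (s * b + a * x) ^+ 2 + (1 - s ^+ 2) *
      (a ^+ 2 * N ^+ 2 + b ^+ 2)); last by rewrite /A /N /E; ring.
    by rewrite s2 subrr mul0r addr0 addr_ge0 ?sqr_ge0.
  have D0 : 0 < A + s * (2 * a * b * x).
    have : 0 < E * y ^+ 2 by rewrite mulr_gt0// exprn_gt0.
    by move=> /lt_le_trans /(_ h); rewrite pmulr_rgt0.
  split=> //; rewrite -[leLHS]mul1r ler_pdivrMr// mulrAC ler_pdivlMr// mul1r.
  by rewrite /L mulrAC ler_pdivlMr ?exprn_gt0.
have [|D1 p1] := form 1; first by rewrite eqxx.
have [|D2 p2] := form (-1); first by rewrite eqxx orbT.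
rewrite mul1r in D1 p1; rewrite mulN1r in D2 p2.
set p := (A + _)^-1 in p1; set m := (A - _)^-1 in p2.
have p0 : 0 <= p by rewrite invr_ge0 ltW.
have m0 : 0 <= m by rewrite invr_ge0 ltW.
have e0 : 0 <= L / E by rewrite divr_ge0 ?ltW.
have -> : (b + a * x) * ((b + a * x) ^+ 2 + 3 * a ^+ 2 * y ^+ 2) /
    (a ^+ 3 * ((b + a * x) ^+ 2 + a ^+ 2 * y ^+ 2) ^+ 2) +
  (- b + a * x) * ((- b + a * x) ^+ 2 + 3 * a ^+ 2 * y ^+ 2) /
    (a ^+ 3 * ((- b + a * x) ^+ 2 + a ^+ 2 * y ^+ 2) ^+ 2) =
  x * a ^- 2 * (- (4 * (b ^+ 2 * (p * m))) + (p + m) +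
    2 * (y ^+ 2 * (a ^+ 2 * (- (8 * (b ^+ 2 * (A * (p * m * (p * m))))) +
      (p * p + m * m))))).
  have -> : (b + a * x) ^+ 2 + 3 * a ^+ 2 * y ^+ 2 =
    A + 2 * a * b * x + 2 * a ^+ 2 * y ^+ 2 by rewrite /A /N; ring.
  have -> : (- b + a * x) ^+ 2 + 3 * a ^+ 2 * y ^+ 2 =
    A - 2 * a * b * x + 2 * a ^+ 2 * y ^+ 2 by rewrite /A /N; ring.
  have -> : (b + a * x) ^+ 2 + a ^+ 2 * y ^+ 2 =
    A + 2 * a * b * x by rewrite /A /N; ring.
  have -> : (- b + a * x) ^+ 2 + a ^+ 2 * y ^+ 2 =
    A - 2 * a * b * x by rewrite /A /N; ring.
  rewrite /p /m; move: (A) D1 D2 => A' D1 D2.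
  by field; rewrite !gt_eqF.
have A0 : 0 <= A by rewrite addr_ge0 ?mulr_ge0 ?ltW.
have AE : A <= (1 + N) * E.
  rewrite -subr_ge0 (_ : _ - _ = a ^+ 2 + N * b ^+ 2); last first.
    by rewrite /A /E; ring.
  by rewrite addr_ge0 ?mulr_ge0 ?ltW.
have bE : b ^+ 2 <= E by rewrite lerDr ltW.
have aE : a ^+ 2 <= E by rewrite lerDl ltW.
have pm0 : 0 <= p * m by exact: mulr_ge0.
have pm : p * m <= L / E * (L / E) by exact: ler_pM.
have t1 : b ^+ 2 * (p * m) <= E * (L / E * (L / E)).
  by apply: ler_pM => //; exact: ltW.
have t2 : b ^+ 2 * (A * (p * m * (p * m))) <=
    E * ((1 + N) * E * (L / E * (L / E) * (L / E * (L / E)))).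
  have ? := ltW b20; apply: ler_pM => //; first by rewrite !mulr_ge0.
  apply: ler_pM => //; first by rewrite mulr_ge0.
  exact: ler_pM.
have t3 : p * p + m * m <= L / E * (L / E) + L / E * (L / E).
  by apply: lerD; exact: ler_pM.
have t30 : 0 <= p * p + m * m by rewrite addr_ge0 ?mulr_ge0.
have t20 : 0 <= b ^+ 2 * (A * (p * m * (p * m))).
  by rewrite !mulr_ge0// ltW.
set T := b ^+ 2 * (A * _) in t2 t20 *.
set U := p * p + m * m in t3 t30 *.
clearbody T U.
have t4 : y ^+ 2 * (a ^+ 2 * (8 * T + U)) <= y ^+ 2 * (E * (8 *
    (E * ((1 + N) * E * (L / E * (L / E) * (L / E * (L / E))))) +
    (L / E * (L / E) + L / E * (L / E)))).
  rewrite ler_wpM2l//; apply: ler_pM => //; first exact: ltW.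
    by rewrite addr_ge0 ?mulr_ge0.
  by rewrite lerD// ler_wpM2l.
rewrite 2!normrM [`|_ ^- 2|]ger0_norm ?invr_ge0 ?(ltW a20)//.
rewrite (_ : a ^- 2 * _ = `|x| * a ^- 2 * (B * b ^- 2)); last by ring.
rewrite ler_wpM2l ?mulr_ge0 ?invr_ge0 ?(ltW a20)//.
apply: (@le_trans _ _ (B / E)); last first.
  by rewrite ler_wpM2l// lef_pV2 ?posrE.
apply: (@le_trans _ _ (4 * (b ^+ 2 * (p * m)) + (p + m) +
    2 * (y ^+ 2 * (a ^+ 2 * (8 * T + U))))).
  have V0 : 0 <= b ^+ 2 * (p * m) by rewrite mulr_ge0 ?(ltW b20).
  set V := b ^+ 2 * _ in V0 *; clearbody V.
  have X0 : 0 <= y ^+ 2 * (a ^+ 2 * T) by rewrite !mulr_ge0// ltW.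
  have Y0 : 0 <= y ^+ 2 * (a ^+ 2 * U) by rewrite !mulr_ge0// ltW.
  have -> : y ^+ 2 * (a ^+ 2 * (- (8 * T) + U)) =
    - (8 * (y ^+ 2 * (a ^+ 2 * T))) + y ^+ 2 * (a ^+ 2 * U) by ring.
  have -> : y ^+ 2 * (a ^+ 2 * (8 * T + U)) =
    8 * (y ^+ 2 * (a ^+ 2 * T)) + y ^+ 2 * (a ^+ 2 * U) by ring.
  move: X0 Y0; move: (y ^+ 2 * (a ^+ 2 * T)) (y ^+ 2 * (a ^+ 2 * U)) => X Y X0 Y0.
  by rewrite ler_norml; apply/andP; split; lra.
have -> : B / E = 4 * (E * (L / E * (L / E))) + (L / E + L / E) +
    2 * (y ^+ 2 * (E * (8 *
    (E * ((1 + N) * E * (L / E * (L / E) * (L / E * (L / E))))) +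
    (L / E * (L / E) + L / E * (L / E))))).
  by rewrite /B; move: (L) (E) E0 => l e e1; field; rewrite gt_eqF.
by rewrite lerD// ?lerD// ler_wpM2l.
Qed.

End modular_relation.

Arguments lambert_term {R}.
Arguments lattice_pair {R}.

(** * The value of zeta(2) *)

Section basel.
Variable R : realType.
Implicit Types (t b : R).

Definition cosh t : R := (expR t + expR (- t)) / 2.
Definition sinh t : R := (expR t - expR (- t)) / 2.

Local Instance is_derive_cosh t : is_derive t (1 : R) cosh (sinh t).
Proof. by apply: is_derive_eq; rewrite /sinh /GRing.scale /=; ring. Qed.

Local Instance is_derive_sinh t : is_derive t (1 : R) sinh (cosh t).
Proof. by apply: is_derive_eq; rewrite /cosh /GRing.scale /=; ring. Qed.

Let ch_ge1 t : 1 <= cosh t.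
Proof. by rewrite /cosh; have := expR_ge1Dx t; have := expR_ge1Dx (- t); lra. Qed.

Let sh0 : sinh 0 = 0. Proof. by rewrite /sinh oppr0 subrr mul0r. Qed.

Let le_sh t : 0 <= t -> t <= sinh t.
Proof.
move=> t0; rewrite -subr_ge0.
have := @le_nondecreasing_derive R (fun u => sinh u - u) (fun u => cosh u - 1) t.
rewrite sh0 subrr; apply => //.
by move=> u _; rewrite subr_ge0.
Qed.

Let sh_le t : 0 <= t -> sinh t <= t * cosh t.
Proof.
move=> t0; rewrite -subr_ge0.
have := @le_nondecreasing_derive R (fun u => u * cosh u - sinh u)
  (fun u => u * sinh u) t.
rewrite sh0 subr0 mul0r; apply => //.
  by move=> u; apply: is_derive_eq; rewrite /GRing.scale /=; ring.
by move=> u /andP[u0 _]; rewrite mulr_ge0// (le_trans u0)// le_sh.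
Qed.

Let numer_ge t : 0 <= t -> t ^+ 3 / 3 <= t * cosh t - sinh t.
Proof.
move=> t0; rewrite -subr_ge0.
have := @le_nondecreasing_derive R (fun u => u * cosh u - sinh u - u ^+ 3 / 3)
  (fun u => u * (sinh u - u)) t.
rewrite sh0 subr0 mul0r expr0n mul0r subr0; apply => //.
  by move=> u; apply: is_derive_eq; rewrite /GRing.scale /=; field.
by move=> u /andP[u0 _]; rewrite mulr_ge0// subr_ge0 le_sh.
Qed.

Let numer_le t : 0 <= t -> t * cosh t - sinh t <= t ^+ 3 / 3 * cosh t.
Proof.
move=> t0; rewrite -subr_ge0.
have := @le_nondecreasing_derive R
  (fun u => u ^+ 3 / 3 * cosh u - (u * cosh u - sinh u))
  (fun u => u * (u * cosh u - sinh u) + u ^+ 3 / 3 * sinh u) t.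
rewrite sh0 !mul0r subr0 expr0n !mul0r subr0; apply => //.
  by move=> u; apply: is_derive_eq; rewrite /GRing.scale /=; field.
move=> u /andP[u0 _]; have su : 0 <= sinh u.
  exact: (le_trans u0 (le_sh _ u0)).
apply: addr_ge0; apply: mulr_ge0 => //; first by rewrite subr_ge0 sh_le.
by apply: divr_ge0 => //; exact: exprn_ge0.
Qed.

(** [t coth t - 1] is [(t cosh t - sinh t) / sinh t]. Integrating
    [t <= sinh t <= t cosh t] shows that the numerator lies between
    [t ^+ 3 / 3] and [t ^+ 3 / 3 * cosh t]. *)
Let coth_bounds t : 0 < t ->
  (3 * cosh t)^-1 <= (t * cosh t / sinh t - 1) / t ^+ 2 <= cosh t / 3.
Proof.
move=> t0; have t0' := ltW t0.
have s0 : 0 < sinh t by apply: lt_le_trans t0 _; exact: le_sh.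
have c0 : 0 < cosh t by apply: lt_le_trans (ch_ge1 t).
have -> : (t * cosh t / sinh t - 1) / t ^+ 2 =
    (t * cosh t - sinh t) / (t ^+ 2 * sinh t).
  by field; rewrite !gt_eqF.
have t2 : 0 < t ^+ 2 by exact: exprn_gt0.
apply/andP; split.
  rewrite ler_pdivlMr; last exact: mulr_gt0.
  rewrite [leLHS]mulrC ler_pdivrMr; last exact: mulr_gt0.
  apply: (@le_trans _ _ (t ^+ 2 * (t * cosh t))).
    by apply: ler_wpM2l; [exact: ltW|exact: sh_le].
  have := ler_wpM2r (ltW c0) (numer_ge _ t0').
  by move: (cosh t) (sinh t) => c s; lra.
rewrite ler_pdivrMr; last exact: mulr_gt0.
apply: le_trans (numer_le _ t0') _.
have -> : cosh t / 3 * (t ^+ 2 * sinh t) = t ^+ 2 * cosh t / 3 * sinh t by ring.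
have -> : t ^+ 3 / 3 * cosh t = t ^+ 2 * cosh t / 3 * t by ring.
apply: ler_wpM2l; last exact: le_sh.
by apply: divr_ge0 => //; apply: mulr_ge0; exact: ltW.
Qed.

(** [eisenstein1] at the point [i b], without the term [k = 0]. *)
Lemma cvg_series_coth b : 0 < b ->
  series (fun k => (k.+1%:R ^+ 2 + b ^+ 2)^-1) @ \oo -->
    pi ^+ 2 / 2 * ((pi * b * cosh (pi * b) / sinh (pi * b) - 1) / (pi * b) ^+ 2).
Proof.
move=> b0; have p0 := pi_gt0 R.
have [_] := eisenstein1 R (0 +i* b) b0.
have nE : nome (0 +i* b) = (expR (- (2 * (pi * b))))%:C.
  by rewrite nomeE mulr0 cos0 sin0 mulr1 mulr0 mulrA.
set r := expR _ in nE.
have r1 : 1 - r != 0.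
  by rewrite subr_eq0 gt_eqF// expR_lt1 oppr_lt0 !mulr_gt0.
rewrite nE (_ : 1 / 2 + _ = (1 / 2 + r / (1 - r))%:C); last first.
  by rewrite rmorphD !fmorph_div rmorphB rmorph1 rmorph_nat.
have -> : complex.Im (- ((2 * pi)%:C * 'i%C) * (1 / 2 + r / (1 - r))%:C) =
    - (2 * pi * (1 / 2 + r / (1 - r))) by simpc.
have termE (k : int) : complex.Im ((0 +i* b) + k%:~R)^-1 =
    - b * (k%:~R ^+ 2 + b ^+ 2)^-1.
  by rewrite -(rmorph_int (real_complex R)) /= add0r addr0 mulNr.
have bn : - (2 * b) != 0 by rewrite oppr_eq0 mulf_neq0// gt_eqF.
move=> H.
have {}H : symmetric_partial_sum (fun k => (k%:~R ^+ 2 + b ^+ 2)^-1) @ \oo -->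
    (2 * pi * (1 / 2 + r / (1 - r))) / b.
  have := cvgMr_tmp (b := - b^-1) H; rewrite mulrN mulNr opprK => H'.
  apply: eq_cvgn (H' _) => K; rewrite /csymmetric_partial_sum.
  have -> : complex.Im (\sum_(i < K.*2.+1) ((0 +i* b) + (i%:Z - K%:Z)%:~R)^-1) =
      - b * symmetric_partial_sum (fun k => (k%:~R ^+ 2 + b ^+ 2)^-1) K.
    rewrite /symmetric_partial_sum mulr_sumr.
    elim: (K.*2.+1) => [|n IH]; first by rewrite !big_ord0.
    by rewrite !big_ord_recr /= ImD IH termE.
  by field; rewrite gt_eqF.
have -> : pi ^+ 2 / 2 * ((pi * b * cosh (pi * b) / sinh (pi * b) - 1) /
    (pi * b) ^+ 2) =
  ((2 * pi * (1 / 2 + r / (1 - r))) / b - (b ^+ 2)^-1) / 2.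
  have rE : r = expR (pi * b) ^- 2.
    by rewrite /r expRN -expRM_natl.
  have u1 : 1 < expR (pi * b) by rewrite expR_gt1 mulr_gt0.
  rewrite /cosh /sinh expRN rE; move: (expR _) u1 => u u1.
  move: p0; move: (pi : R) => p p0.
  have u0 : u != 0 by rewrite gt_eqF// (lt_trans ltr01).
  have u2 : u ^+ 2 - 1 != 0.
    by rewrite subr_eq0 gt_eqF// exprn_egt1.
  by field; rewrite u0 u2 !gt_eqF.
have H2 : (fun K => (symmetric_partial_sum
    (fun k => (k%:~R ^+ 2 + b ^+ 2)^-1) K - (b ^+ 2)^-1) / 2) @ \oo -->
    (2 * pi * (1 / 2 + r / (1 - r)) / b - (b ^+ 2)^-1) / 2.
  by apply: cvgMr_tmp; apply: cvgB => //; exact: cvg_cst.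
apply: eq_cvgn H2 => K; rewrite symmetric_partial_sumE.
rewrite expr0n add0r addrAC subrr add0r /series /= mulr_suml.
apply: eq_bigr => k _; rewrite rmorphN /= -pmulrn sqrrN.
by rewrite [RHS]mulrDl -splitr.
Qed.

(** When [b] tends to 0, the series of [1 / (k ^+ 2 + b ^+ 2)] tends to [zeta 2]
    and its closed form, [cvg_series_coth], to [pi ^+ 2 / 6]. *)
Lemma zeta2 : zeta R 2 = pi ^+ 2 / 6.
Proof.
have p0 := pi_gt0 R.
pose b (m : nat) : R := m.+1%:R^-1.
have b0 m : 0 < b m by rewrite invr_gt0.
pose S m := pi ^+ 2 / 2 * ((pi * b m * cosh (pi * b m) / sinh (pi * b m) - 1) /
  (pi * b m) ^+ 2).
have HS m : series (fun k => (k.+1%:R ^+ 2 + b m ^+ 2)^-1) @ \oo --> S m :=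
  cvg_series_coth (b m) (b0 m).
have Hz := cvg_series_invn2 R; rewrite -/(zeta R 2) in Hz.
have Sz m : S m <= zeta R 2.
  rewrite -(cvg_lim _ (HS m))//; apply: ler_lim.
  - exact: cvgP (HS m).
  - exact: Hz.
  - apply: nearW => K; apply: ler_sum => k _.
    by rewrite lef_pV2 ?posrE ?addr_gt0 ?exprn_gt0// lerDl exprn_ge0// ltW.
(* (1 - c) (t + c) <= t for t >= 1. *)
have zS m : (1 - b m ^+ 2) * zeta R 2 <= S m.
  have := cvg_seriesM _ _ (1 - b m ^+ 2) _ Hz => H.
  rewrite -(cvg_lim _ (HS m))// -(cvg_lim _ H)//; apply: ler_lim.
  - exact: cvgP H.
  - exact: cvgP (HS m).
  apply: nearW => K; apply: ler_sum => k _.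
  have k1 : 1 <= k.+1%:R ^+ 2 :> R by rewrite exprn_ege1// ler1n.
  have b20 : 0 < b m ^+ 2 by rewrite exprn_gt0.
  have k0 : 0 < k.+1%:R ^+ 2 :> R by rewrite exprn_gt0.
  move: (k.+1%:R ^+ 2) (b m ^+ 2) k1 b20 k0 => t c t1 c0 t0.
  rewrite ler_pdivrMr// mulrC ler_pdivlMr ?addr_gt0//; nra.
have b_to0 : (fun m => pi * b m) @ \oo --> (0 : R).
  by rewrite -[0](mulr0 pi); apply: cvgMl_tmp; exact: cvg_harmonic.
have cosh_to1 : (fun m => cosh (pi * b m)) @ \oo --> (1 : R).
  have -> : 1 = (expR 0 + expR (- 0)) / 2 :> R by rewrite oppr0 expR0; field.
  apply: cvgMr_tmp; apply: cvgD.
    exact: (cvg_comp _ _ b_to0 (@continuous_expR R 0)).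
  have bN : (fun m => - (pi * b m)) @ \oo --> (- 0 : R) by exact: cvgN.
  exact: (cvg_comp _ _ bN (@continuous_expR R (- 0))).
have bounds m : pi ^+ 2 / 6 * (cosh (pi * b m))^-1 <= S m <=
    pi ^+ 2 / 6 * cosh (pi * b m).
  have /andP[h1 h2] := coth_bounds _ (mulr_gt0 p0 (b0 m)).
  rewrite /S; have -> : pi ^+ 2 / 6 * (cosh (pi * b m))^-1 =
    pi ^+ 2 / 2 * (3 * cosh (pi * b m))^-1.
    move: (lt_le_trans ltr01 (ch_ge1 (pi * b m)));
      set c := cosh _; move: c => c c0; move: (pi : R) => p.
    by field; rewrite gt_eqF.
  have -> : pi ^+ 2 / 6 * cosh (pi * b m) =
    pi ^+ 2 / 2 * (cosh (pi * b m) / 3).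
    by set c := cosh _; move: c => c; move: (pi : R) => p; field.
  by rewrite !ler_wpM2l// divr_ge0// exprn_ge0// ltW.
apply/eqP; rewrite eq_le; apply/andP; split.
  have c1 : (fun m => (1 - b m ^+ 2) * zeta R 2) @ \oo --> (1 - 0 ^+ 2) * zeta R 2.
    apply: cvgMr_tmp; apply: cvgB; first exact: cvg_cst.
    by rewrite expr2; apply: cvgM; exact: cvg_harmonic.
  have c2 : (fun m => pi ^+ 2 / 6 * cosh (pi * b m)) @ \oo -->
      (pi ^+ 2 / 6 * 1 : R) by exact: cvgMl_tmp.
  suff : (1 - 0 ^+ 2) * zeta R 2 <= pi ^+ 2 / 6 * 1.
    by rewrite expr0n subr0 mul1r mulr1.
  rewrite -(cvg_lim _ c1)// -(cvg_lim _ c2)//.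
  apply: ler_lim; [exact: cvgP c1|exact: cvgP c2|apply: nearW => m].
  by apply: le_trans (zS m) _; have /andP[] := bounds m.
have c3 : (fun m => pi ^+ 2 / 6 * (cosh (pi * b m))^-1) @ \oo -->
    (pi ^+ 2 / 6 * 1^-1 : R).
  by apply: cvgMl_tmp; apply: cvgV => //; exact: oner_neq0.
suff : pi ^+ 2 / 6 * 1^-1 <= zeta R 2 by rewrite invr1 mulr1.
rewrite -(cvg_lim _ c3)//; apply: limr_le; first exact: cvgP c3.
by apply: nearW => m; apply: le_trans (Sz m); have /andP[] := bounds m.
Qed.

End basel.

(** * The odd part under inversion, and the value of zeta(4) *)

Section zeta_values.
Variable R : realType.
Implicit Types (x y : R).

Lemma cvg_zeta k : (1 < k)%N ->
  series (fun n => n.+1%:R ^- k : R) @ \oo --> zeta R k.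
Proof.
move=> k1; rewrite /zeta; apply: series_le_cvg (cvg_series_invn2 R) => n.
- by rewrite invr_ge0 exprn_ge0.
- by rewrite invr_ge0 exprn_ge0.
- rewrite lef_pV2 ?posrE ?exprn_gt0//; apply: ler_weXn2l => //.
  by rewrite ler1n.
Qed.

(** Absolute convergence of the pairs allows both orders of summation. Summing
    over [k] first gives the odd part at [tau], without the terms [k = 0];
    [lattice_pair_modular] turns the sum over [n] into the odd part at
    [-1 / tau], without its own terms [k = 0], minus [2 x / (n ^+ 2 k ^+ 2)]. *)
Lemma lambert_term_modular x y B B' : 0 < y ->
  let N := x ^+ 2 + y ^+ 2 in
  series (fun n => 2 * pi * complex.Im (lambert_term x y n)) @ \oo --> B ->
  series (fun n => 2 * pi * complex.Im (lambert_term (- x / N) (y / N) n))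
    @ \oo --> B' ->
  B = N * B' + x * ((x ^+ 2 + 3 * y ^+ 2) * (N ^- 2 + 1) * zeta R 4 -
                    2 * zeta R 2 ^+ 2).
Proof.
move=> y0 N HB HB'.
have N0 : 0 < N by rewrite ltr_wpDl ?sqr_ge0// exprn_gt0.
have y0' : 0 < y / N by rewrite divr_gt0.
have z2 := cvg_zeta 2 isT; have z4 := cvg_zeta 4 isT.
have [C C0 bound] := lattice_pair_bound R x y y0.
have row n := cvg_lattice_pair R x y n y0.
have col k : series (fun n => lattice_pair x y n k) @ \oo -->
    N * (2 * pi * complex.Im (lambert_term (- x / N) (y / N) k) -
         lattice_term (- x / N) (y / N) k.+1%:Z 0) -
    2 * x * zeta R 2 * k.+1%:R ^- 2.
  have -> : (fun n => lattice_pair x y n k) =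
      fun n => N * lattice_pair (- x / N) (y / N) k n -
        (2 * x * k.+1%:R ^- 2) * n.+1%:R ^- 2.
    by apply/funext => n; rewrite lattice_pair_modular// -/N; ring.
  rewrite [2 * x * _ * _]mulrAC; apply: cvg_series_sub.
    by apply: cvg_seriesM; exact: cvg_lattice_pair.
  exact: cvg_seriesM.
have inv0 (n : nat) : 0 <= n.+1%:R ^- 2 :> R by rewrite invr_ge0 exprn_ge0.
have [S [rowS colS]] := series_exchange _ _ _ _ _ _ (cvg_series_invn2 R)
  (cvgP _ (cvg_seriesM _ _ C _ z2)) inv0 (fun k => mulr_ge0 C0 (inv0 k))
  bound row col.
have rowS' : series (fun n => 2 * pi * complex.Im (lambert_term x y n) -
   lattice_term x y n.+1%:Z 0) @ \oo -->
   B - x * (x ^+ 2 + 3 * y ^+ 2) / N ^+ 2 * zeta R 4.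
  apply: cvg_series_sub => //.
  rewrite (_ : (fun n => _) = fun n : nat =>
    x * (x ^+ 2 + 3 * y ^+ 2) / N ^+ 2 * n.+1%:R ^- 4).
    exact: cvg_seriesM.
  by apply/funext => n; rewrite lattice_term0.
have colS' : series (fun k =>
    N * (2 * pi * complex.Im (lambert_term (- x / N) (y / N) k) -
         lattice_term (- x / N) (y / N) k.+1%:Z 0) -
    2 * x * zeta R 2 * k.+1%:R ^- 2) @ \oo -->
  N * (B' + x * (x ^+ 2 + 3 * y ^+ 2) / N * zeta R 4) -
    2 * x * zeta R 2 * zeta R 2.
  apply: cvg_series_sub; last exact: cvg_seriesM.
  apply: cvg_seriesM; rewrite -[x * _ / N * _]opprK; apply: cvg_series_sub => //.
  rewrite (_ : (fun n => _) = fun n : nat =>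
    - (x * (x ^+ 2 + 3 * y ^+ 2) / N) * n.+1%:R ^- 4).
    by rewrite -[X in _ --> X]mulNr; exact: cvg_seriesM.
  apply/funext => n; rewrite lattice_term0//; congr (_ * _).
  have N1 : x ^+ 2 + y ^+ 2 != 0 by rewrite gt_eqF.
  have -> : (- x / N) ^+ 2 + (y / N) ^+ 2 = N^-1 by rewrite /N; field.
  by move: (N) N0 => M M0; field; rewrite gt_eqF.
have e1 := cvg_unique _ rowS rowS'; have e2 := cvg_unique _ colS colS'.
have N1 : N != 0 by rewrite gt_eqF.
have -> : B = x * (x ^+ 2 + 3 * y ^+ 2) / N ^+ 2 * zeta R 4 +
  (N * (B' + x * (x ^+ 2 + 3 * y ^+ 2) / N * zeta R 4) -
    2 * x * zeta R 2 * zeta R 2) by rewrite -e2 // e1 // addrC subrK.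
by move: (N) N1 => M M0; field.
Qed.

(** [exp (i pi m)] is a square root of 1. *)
Lemma nome_half_int (m : int) y : exists r : R,
  nome ((m%:~R / 2) +i* y) = r%:C.
Proof.
have [s sE] : exists s : R, nome (m%:~R / 2)%:C = s%:C.
  suff : nome (m%:~R / 2 : R)%:C == 1 \/ nome (m%:~R / 2 : R)%:C == -1.
    case=> /eqP ->; first by exists 1.
    by exists (-1); rewrite rmorphN rmorph1.
  apply/orP; rewrite -sqrf_eq1 -nomeMn.
  rewrite (_ : 2%:R * (m%:~R / 2)%:C = m%:~R) ?nome_int//.
  by rewrite fmorph_div rmorph_int rmorph_nat; field.
exists (s * expR (- (2 * pi * y))).
have -> : (m%:~R / 2) +i* y = (m%:~R / 2)%:C + 0 +i* y by simpc.
by rewrite nomeD sE nomeE mulr0 cos0 sin0 mulr1 mulr0 rmorphM.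
Qed.

Lemma Im_lambert_term_half_int (m : int) y n :
  complex.Im (lambert_term (m%:~R / 2) y n) = 0.
Proof.
have [r rE] := nome_half_int m y; rewrite /lambert_term /lambert rE.
rewrite -(rmorphXn (real_complex R)); move: (r ^+ n.+1) => w.
rewrite (_ : _ * _ = (n.+1%:R ^- 3 * (w / (1 - w) + 2 * pi * (n.+1%:R * y) *
  (w / (1 - w) ^+ 2)))%:C)//.
have key (f : {rmorphism R -> R[i]}) (a b : R) :
    f a * (f w / (1 - f w) + f b * (f w / (1 - f w) ^+ 2)) =
    f (a * (w / (1 - w) + b * (w / (1 - w) ^+ 2))).
  by rewrite !(rmorphM, rmorphD, fmorphV, rmorphXn, rmorphN, rmorph1).
exact: (key (real_complex R)).
Qed.

Lemma cvg_lambert_term_half_int (m : int) y :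
  series (fun n => 2 * pi * complex.Im (lambert_term (m%:~R / 2) y n))
    @ \oo --> (0 : R).
Proof.
rewrite (_ : (fun n => _) = fun=> 0).
  by rewrite /series /=; under eq_fun do rewrite big1//; exact: cvg_cst.
by apply/funext => n; rewrite Im_lambert_term_half_int mulr0.
Qed.

(** At [tau = (1 + i) / 2] the numbers [tau] and [-1 / tau = -1 + i] both have a real
    part in [1/2 Z], so the odd part vanishes at both ends of
    [lambert_term_modular]. *)
Lemma zeta4_zeta2 : 5 * zeta R 4 = 2 * zeta R 2 ^+ 2.
Proof.
have half0 : 0 < 2^-1 :> R by rewrite invr_gt0.
have N2 : 2^-1 ^+ 2 + 2^-1 ^+ 2 = 2^-1 :> R by field.
have := lambert_term_modular 2^-1 2^-1 0 0 half0.
rewrite N2; cbv zeta.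
have -> : - 2^-1 / 2^-1 = -1 :> R by field.
have -> : 2^-1 / 2^-1 = 1 :> R by field.
have e1 : 2^-1 = (Posz 1)%:~R / 2 :> R by rewrite -pmulrn mul1r.
have e2 : -1 = (- (Posz 2))%:~R / 2 :> R.
  by rewrite mulrNz -pmulrn mulNr divff.
have h1 : series (fun n => 2 * pi * complex.Im (lambert_term 2^-1 2^-1 n))
    @ \oo --> (0 : R) by rewrite {1}e1; exact: cvg_lambert_term_half_int.
have h2 : series (fun n => 2 * pi * complex.Im (lambert_term (-1) 1 n))
    @ \oo --> (0 : R) by rewrite e2; exact: cvg_lambert_term_half_int.
move=> /(_ h1 h2); move: (zeta R 4) (zeta R 2 ^+ 2) => z z' h.
move: h; lra.
Qed.

Lemma zeta4 : zeta R 4 = pi ^+ 4 / 90.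
Proof.
by have := zeta4_zeta2; rewrite zeta2; move: (zeta R 4) (pi : R) => z p h; lra.
Qed.

End zeta_values.

(** * The Epstein zeta function *)

Section epstein.
Variable R : realType.
Implicit Types (x y : R).

(** Row by row: the row [n = 0] gives [2 zeta 4], and the rows [n] and [-n] have
    the same sum, given by [cvg_symmetric_epstein]. *)
Lemma epstein_zetaE x y a : 0 < y ->
  series (fun n => complex.Re (lambert_term x y n)) @ \oo --> a ->
  epstein_zeta 1 (2 * x) (x ^+ 2 + y ^+ 2) 2 =
  2 * zeta R 4 + (pi * zeta R 3 + 2 * pi * a) / y ^+ 3.
Proof.
move=> y0 Ha.
pose h (n k : int) : R := ((k%:~R + n%:~R * x) ^+ 2 + (n%:~R * y) ^+ 2) ^- 2.
have h0 n k : 0 <= h n k by rewrite invr_ge0 exprn_ge0// addr_ge0 ?sqr_ge0.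
have hN n k : h (- n) (- k) = h n k.
  rewrite /h !rmorphN /= (_ : - _ + - _ * x = - (k%:~R + n%:~R * x)); last by ring.
  by rewrite sqrrN mulNr sqrrN.
(* The sum of the row n; lambert_term has its index shifted by one. *)
pose e (n : int) : R := if n == 0 then 2 * zeta R 4 else
  (pi * `|n|%N%:R ^- 3 + 2 * pi * complex.Re (lambert_term x y `|n|.-1)) /
  (2 * y ^+ 3).
have eN n : e (- n) = e n by rewrite /e oppr_eq0 abszN.
have sums_nat (m : nat) : symmetric_partial_sum (h m) @ \oo --> e m.
  case: m => [|m]; last first.
    apply: eq_cvgn (cvg_symmetric_epstein R x y m y0) => K.
    by rewrite /symmetric_partial_sum; apply: eq_bigr => i _; rewrite /h -pmulrn.
  have := symmetric_even R (h 0) (zeta R 4).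
  have -> : h 0 0 = 0 by rewrite /h !mul0r addr0 !expr0n addr0 expr0n invr0.
  rewrite add0r; apply => [k|]; first by rewrite -{1}[0]oppr0 hN.
  rewrite (_ : (fun n => _) = fun n : nat => n.+1%:R ^- 4); first exact: cvg_zeta.
  apply/funext => k; rewrite /h !mul0r expr0n !addr0 -pmulrn.
  by rewrite -exprM.
have sums n : symmetric_partial_sum (h n) @ \oo --> e n.
  have [m [->|->]] : exists m : nat, n = m%:Z \/ n = - m%:Z.
    by exists `|n|%N; lia.
    exact: sums_nat.
  rewrite eN; apply: eq_cvgn (sums_nat m) => K.
  rewrite !symmetric_partial_sumE; congr (_ + _).
    by rewrite -[0 in LHS]oppr0 hN.
  apply: eq_bigr => k _; rewrite addrC; congr (_ + _); first by rewrite hN.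
  by rewrite -[k.+1%:Z in LHS]opprK hN.
have e0 n : 0 <= e n.
  rewrite -lee_fin -(esum_int _ _ _ (h0 n) (sums n)).
  by apply: esum_ge0 => k _; rewrite lee_fin.
rewrite /epstein_zeta.
have -> : \esum_(p in [set p : int * int | p <> (0, 0)])
    (((1 * p.1%:~R ^+ 2 + 2 * x * p.1%:~R * p.2%:~R +
      (x ^+ 2 + y ^+ 2) * p.2%:~R ^+ 2) `^ 2)^-1)%:E =
    \esum_(p in [set: int * int]) (h p.2 p.1)%:E.
  rewrite esum_mkcond; apply: eq_esum => -[k n] _ /=.
  have [[-> ->]|kn] := eqVneq (k, n) (0, 0).
    rewrite memNset => [|/(_ erefl)//].
    by rewrite /h !mul0r addr0 !expr0n addr0 expr0n invr0.
  rewrite mem_set/=; last exact/eqP.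
  congr (_%:E); rewrite /h; move: (k%:~R) (n%:~R) => b c.
  have -> : 1 * b ^+ 2 + 2 * x * b * c + (x ^+ 2 + y ^+ 2) * c ^+ 2 =
    (b + c * x) ^+ 2 + (c * y) ^+ 2 by ring.
  by rewrite (powR_mulrn 2)// addr_ge0 ?sqr_ge0.
rewrite (reindex_esum [set: int * int] _ (fun p => (p.2, p.1))); last first.
  split=> //=; first by move=> [i j] [i' j'] _ _ /= [-> ->].
  by move=> [i j] _; exists (j, i).
rewrite /= (_ : [set: int * int] = [set: int] `*`` (fun=> [set: int])); last first.
  by apply/seteqP; split.
rewrite -(esum_esum (a := fun n k => (h n k)%:E)); last first.
  by move=> i j _ _; rewrite lee_fin.
under eq_esum do rewrite (esum_int _ _ _ (h0 _) (sums _)).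
rewrite (esum_int _ e (e 0 + 2 * ((pi * zeta R 3 + 2 * pi * a) / (2 * y ^+ 3))))//=.
  by rewrite /e eqxx; field; rewrite gt_eqF.
apply: symmetric_even => //.
rewrite (_ : (fun n => _) = fun n : nat => (2 * y ^+ 3)^-1 *
  (pi * n.+1%:R ^- 3 + 2 * pi * complex.Re (lambert_term x y n))).
  rewrite [X in _ --> X]mulrC; apply: cvg_seriesM; apply: cvg_seriesD.
    by apply: cvg_seriesM; exact: cvg_zeta.
  exact: cvg_seriesM.
by apply/funext => n; rewrite /e /= mulrC.
Qed.

End epstein.

(** * The three formulas for F *)

Lemma mulr_i_real (R : realType) (c t : R) (z : R[i]) :
  z = c%:C -> z * 'i%C * t%:C = 0 +i* (c * t).
Proof. by move=> ->; simpc. Qed.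

Theorem proposition3 (R : realType) (x y : R) (hy : 0 < y) :
  let tau : R[i] := x +i* y in
  let q : R[i] := cexp ((2 * pi)%:C * 'i%C * tau) in
  let epstein_part : R :=
    120 * y ^+ 3 / pi ^+ 2 * epstein_zeta 1 (2 * x) (x ^+ 2 + y ^+ 2) 2 in
  let nonzero : set int := [set n : int | n <> 0] in
  let inner : int -> R := fun n => symmetric_sum (lattice_term x y n) in
  [/\ [/\ forall n : int, n <> 0 ->
            cvgn (symmetric_partial_sum (lattice_term x y n)),
          summable nonzero (EFin \o inner) &
          F q = epstein_part%:C
                + (60 * 'i%C / pi%:C ^+ 2)
                  * (unordered_sum nonzero inner)%:C],
      (exists m : int, x = m%:~R / 2) -> F q = epstein_part%:C &
      (exists m : int, 2 * x / (x ^+ 2 + y ^+ 2) = m%:~R) ->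
        F q = epstein_part%:C
              + (4 * 'i%C * pi%:C ^+ 2 / 3)
                * (x * ((x ^+ 2 + 3 * y ^+ 2) / (x ^+ 2 + y ^+ 2) ^+ 2
                        + x ^+ 2 + 3 * y ^+ 2 - 5))%:C].
Proof.
move=> tau q epstein_part nonzero inner.
have pi0 : (pi : R) != 0 by rewrite gt_eqF// pi_gt0.
have [[C bC] [S [/ccvg_seriesP[HRe HIm] Fq]]] := ccvg_lambert_term R x y hy.
have cvg_inner n : symmetric_partial_sum (lattice_term x y n.+1%:Z) @ \oo -->
    2 * pi * complex.Im (lambert_term x y n) by exact: cvg_symmetric_lattice.
have innerE (n : nat) : inner n.+1%:Z = 2 * pi * complex.Im (lambert_term x y n).
  exact: cvg_lim (cvg_inner n).
have innerN n : inner (- n) = inner n.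
  by rewrite /inner /symmetric_sum symmetric_lattice_termN.
set B := 2 * pi * complex.Im S.
have HB : series (fun n => 2 * pi * complex.Im (lambert_term x y n)) @ \oo --> B.
  exact: cvg_seriesM.
have HB' : series (fun n => inner n.+1%:Z) @ \oo --> B.
  rewrite (_ : (fun n : nat => inner n.+1%:Z) = fun n =>
    2 * pi * complex.Im (lambert_term x y n))//.
  by apply/funext => n; exact: innerE.
have abs_inner : cvgn (series (fun n => `|inner n.+1%:Z|)).
  have bnd n : `|inner n.+1%:Z| <= 2 * pi * C * n.+1%:R ^- 2.
    have pp : 0 <= 2 * pi :> R by rewrite mulr_ge0// pi_ge0.
    by rewrite innerE normrM ger0_norm// -mulrA ler_wpM2l//; exact: bC.
  apply: series_le_cvg
    (cvgP _ (cvg_seriesM _ _ (2 * pi * C) _ (cvg_series_invn2 R))) => n.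
  - exact: normr_ge0.
  - exact: le_trans (normr_ge0 _) (bnd n).
  - exact: bnd.
have [sum_inner unordered] := unordered_sum_even R inner B innerN abs_inner HB'.
have FqE : F q = epstein_part%:C +
    (60 * 'i%C / pi%:C ^+ 2) * (2 * B)%:C.
  have -> : (60 * 'i%C / pi%:C ^+ 2) * (2 * B)%:C =
      0 +i* (60 / pi ^+ 2 * (2 * B)).
    rewrite -(mulr_i_real _ _ _ (60 / pi%:C ^+ 2)).
      by rewrite [60 * _ / _]mulrAC.
    by rewrite fmorph_div rmorphXn rmorph_nat.
  rewrite [LHS]Fq /epstein_part (epstein_zetaE R x y _ hy HRe) zeta4 /B.
  case: (S) => a b /=; simpc; congr Complex.
    move: (zeta R 3) pi0; move: (pi : R) => p z p0.
    by field; rewrite p0 gt_eqF.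
  by move: pi0; move: (pi : R) => p p0; field.
have half_int (m : int) : x = m%:~R / 2 -> B = 0.
  move=> xE; have H0 : series (fun n => 2 * pi *
      complex.Im (lambert_term x y n)) @ \oo --> (0 : R).
    by rewrite xE; exact: cvg_lambert_term_half_int.
  exact: (cvg_unique _ HB H0).
split; first split.
- move=> n n0; have [m [->|->]] : exists m : nat, n = m.+1%:Z \/ n = - m.+1%:Z.
    by exists `|n|.-1; lia.
  + exact: cvgP (cvg_inner m).
  + by rewrite symmetric_lattice_termN; exact: cvgP (cvg_inner m).
- exact: sum_inner.
- by rewrite unordered; exact: FqE.
- by move=> [m xE]; rewrite FqE (half_int m xE) mulr0 mulr0 addr0.
move=> [m mE].
set N := x ^+ 2 + y ^+ 2 in mE *.
have N0 : 0 < N by rewrite ltr_wpDl ?sqr_ge0// exprn_gt0.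
have x'E : - x / N = (- m)%:~R / 2 by rewrite mulrNz -mE; field; rewrite gt_eqF.
have HB0 : series (fun n => 2 * pi *
    complex.Im (lambert_term (- x / N) (y / N) n)) @ \oo --> (0 : R).
  by rewrite x'E; exact: cvg_lambert_term_half_int.
rewrite FqE (lambert_term_modular R x y B 0 hy HB HB0) -/N zeta4 zeta2.
congr (_ + _).
rewrite (_ : 60 * 'i%C / pi%:C ^+ 2 = 60 / pi%:C ^+ 2 * 'i%C); last first.
  by rewrite mulrAC.
rewrite (_ : 4 * 'i%C * pi%:C ^+ 2 / 3 = 4 * pi%:C ^+ 2 / 3 * 'i%C); last first.
  by move: 'i%C (pi%:C) => i p; ring.
rewrite (mulr_i_real _ (60 / pi ^+ 2) _ (60 / pi%:C ^+ 2)); last first.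
  by rewrite fmorph_div rmorphXn rmorph_nat.
rewrite (mulr_i_real _ (4 * pi ^+ 4 / 3 / pi ^+ 2) _ (4 * pi%:C ^+ 2 / 3)); last first.
  rewrite (_ : 4 * pi ^+ 4 / 3 / pi ^+ 2 = 4 * pi ^+ 2 / 3).
    by rewrite fmorph_div rmorphM rmorphXn !rmorph_nat.
  by move: pi0; move: (pi : R) => p p0; field.
congr Complex.
move: pi0; move: (pi : R) => p p0; move: (N) N0 => M M0.
by field; rewrite p0 gt_eqF.
Qed.
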